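(* Let $p$ be a Fermat prime or a safe prime and $G=\mathbb{Z}\times\mathbb{Z}_p=\langle z\rangle\times\langle a\rangle$. If $\mathcal{S}$ is a Schur ring over $G$ such that $\mathbb{Z}^{(p)}=\langle z^p\rangle$ is an $\mathcal{S}$-subgroup, then $\mathcal{S}$ is an automorphic Schur ring.
   Context: $F$ is a field of characteristic $0$; $\mathbb{Z}=\langle z\rangle$ infinite cyclic, $\mathbb{Z}_p=\langle a\rangle$ cyclic of order $p$, written multiplicatively. For finite $C\subseteq G$, $\overline{C}=\sum_{g\in C}g$ and $C^*=\{g^{-1}:g\in C\}$. A Schur ring over $G$ is a subspace $\mathcal{S}=\mathrm{Span}_F\{\overline{C}:C\in\mathcal{D}\}$ of $F[G]$, where $\mathcal{D}$ is a partition of $G$ into finite subsets with $\{1\}\in\mathcal{D}$, $C\in\mathcal{D}\Rightarrow C^*\in\mathcal{D}$, and each $\overline{C}\,\overline{D}$ a finite $F$-linear combination of the $\overline{E}$, $E\in\mathcal{D}$; an $\mathcal{S}$-subgroup is a subgroup that is a union of members of $\mathcal{D}$. $\mathcal{S}$ is automorphic if $\mathcal{S}=F[G]^{\mathcal{H}}$ (elements fixed by $\mathcal{H}$; classes the $\mathcal{H}$-orbits) for some finite $\mathcal{H}\le\operatorname{Aut}(G)$. A Fermat prime is a prime of the form $2^k+1$; a safe prime is a prime $p=2q+1$ with $q$ prime. *)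

(* Defs.v *)
From HB Require Import structures.
From mathcomp Require Import all_boot all_order all_algebra.
Set Implicit Arguments. Unset Strict Implicit. Unset Printing Implicit Defensive.
Import GRing.Theory.
Local Open Scope ring_scope.
From Stdlib Require List.
Local Open Scope ring_scope.

(* G = Z x Z_p, written additively: z^k a^j  <->  (k, j). *)
Definition grp (p : nat) : zmodType := (int * 'Z_p)%type.

(* A Schur ring over G is given by its partition D, encoded by
   cls x = the (finite, duplicate-free) list of elements of the class of x. *)
Record is_schur_ring (F : fieldType) (p : nat) (cls : grp p -> seq (grp p)) : Prop := {
  sr_uniq  : forall x, uniq (cls x);
  sr_refl  : forall x, x \in cls x;
  sr_class : forall x y, y \in cls x -> cls y =i cls x;
  sr_one   : forall y, y \in cls 0 -> y = 0;
  sr_inv   : forall x y, y \in cls x -> - y \in cls (- x);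
  (* \bar C * \bar D (C = class of x, D = class of y) is a finite F-linear
     combination of class sums; its coefficient at g is #{c in C | g - c in D}. *)
  sr_mul   : forall x y, exists (n : nat) (e : 'I_n -> grp p) (lam : 'I_n -> F),
      forall g, (count (fun c => g - c \in cls y) (cls x))%:R
                = \sum_(i < n) lam i * (g \in cls (e i))%:R }.

Definition zp_sub (p : nat) (x : grp p) : bool :=
  ((p%:Z %| x.1)%Z && (x.2 == 0)).

Definition is_S_subgroup (p : nat) (cls : grp p -> seq (grp p)) (H : grp p -> bool) :=
  forall x y, H x -> y \in cls x -> H y.

Definition is_aut (p : nat) (h : grp p -> grp p) : Prop :=
  (forall x y, h (x + y) = h x + h y) /\ bijective h.

Record fin_aut_subgroup (p : nat) (hs : seq (grp p -> grp p)) : Prop := {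
  fa_aut  : forall h, List.In h hs -> is_aut h;
  fa_id   : exists2 h, List.In h hs & h =1 id;
  fa_comp : forall h1 h2, List.In h1 hs -> List.In h2 hs ->
              exists2 h, List.In h hs & h =1 h1 \o h2;
  fa_inv  : forall h1, List.In h1 hs ->
              exists2 h, List.In h hs & (forall x, h (h1 x) = x) }.

(* S = F[G]^H : the classes of S are exactly the H-orbits. *)
Definition is_automorphic (p : nat) (cls : grp p -> seq (grp p)) : Prop :=
  exists hs : seq (grp p -> grp p), fin_aut_subgroup hs /\
    forall x y, y \in cls x <-> exists2 h, List.In h hs & h x = y.

Definition fermat_prime (p : nat) : Prop := prime p /\ exists k, p = (2 ^ k).+1.
Definition safe_prime (p : nat) : Prop := prime p /\ exists2 q, prime q & p = (2 * q).+1.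

(* Main.v *)
From HB Require Import structures.
From mathcomp Require Import all_boot all_order all_algebra finmap zify ring.
From mathcomp Require Import monalg.
From Stdlib Require Import Classical_Prop.
Require Import Defs.
Set Implicit Arguments. Unset Strict Implicit. Unset Printing Implicit Defensive.
Import Order.TTheory GRing.Theory Num.Theory.
Local Open Scope ring_scope.

(* Reducing powers of class sums modulo
   primes shows that multiplication by an integer prime to p maps classes onto
   unions of classes, and hence that the class of an element of level k (its
   Z-coordinate) lies in the levels k and -k.

   If the class of z contains the whole coset z Z_p, then every level prime to p
   is full, translations z -> z a^i preserve all classes, and only the classes
   of <z^p> x Z_p remain to be understood.  Otherwise let X be the part at
   level 1 of the class of z.  It is a unit of F_p[G], since X^p is a nonzero
   multiple of a group element.  The product U of the conjugates s_m(X)^(n_m)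
   over m in F_p^*, where s_m is induced by x -> m x and m n_m = -1 mod p, has
   for the derivation D (z^k a^j) = j z^k a^j the logarithmic derivative
   D U / U = - sum_m s_m (D X / X), which is invariant under all s_m; comparing
   coefficients in D U = (alpha + beta sum_j a^j) U forces U to be a single
   monomial.  Since U is the top level part of an element of the Schur ring, some
   element of level 1 is alone in its class at that level and can replace z.

   In either case there remains a subgroup <b> x Z_p in which the class of b lies
   in {b, b'} with b' of opposite level.  There the torsion part of the class of
   b^k a^j does not depend on k <> 0 and is equivariant in j under F_p^*, so it is
   swept out by automorphisms b -> b or b', a -> a^i. *)

(** * Group algebras *)

Section LinearExtension.
Variables (K : comNzRingType) (G : choiceType) (V : lmodType K).
Implicit Types (h : G -> V) (f g : {malg K[G]}).

Definition linext h f : V := \sum_(x <- msupp f) f@_x *: h x.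

Lemma linextEw h (d : {fset G}) f : (msupp f `<=` d)%fset ->
  linext h f = \sum_(x <- d) f@_x *: h x.
Proof.
move=> le; rewrite /linext [LHS](big_fset_incl _ le) => //= x xd /mcoeff_outdom ->.
by rewrite scale0r.
Qed.

Lemma linextP h a f g : linext h (a *: f + g) = a *: linext h f + linext h g.
Proof.
pose d := (msupp f `|` msupp g `|` msupp (a *: f + g))%fset.
have s1 : (msupp f `<=` d)%fset by rewrite /d -fsetUA fsubsetUl.
have s2 : (msupp g `<=` d)%fset.
  by rewrite /d [(msupp f `|` _)%fset]fsetUC -fsetUA fsubsetUl.
have s3 : (msupp (a *: f + g) `<=` d)%fset by rewrite fsubsetUr.
rewrite (linextEw _ s1) (linextEw _ s2) (linextEw _ s3) scaler_sumr -big_split /=.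
by apply: eq_bigr => x _; rewrite mcoeffD mcoeffZ scalerDl scalerA.
Qed.

HB.instance Definition _ h :=
  GRing.isLinear.Build K {malg K[G]} V _ (linext h) (linextP h).

Lemma linextU h x : linext h << x >> = h x.
Proof. by rewrite (linextEw _ msuppU_le) big_seq_fset1 mcoeffUU scale1r. Qed.

Lemma malg_ind (P : {malg K[G]} -> Prop) :
  P 0 -> (forall a f g, P f -> P g -> P (a *: f + g)) -> (forall x, P << x >>) ->
  forall f, P f.
Proof.
move=> P0 PD PU f; rewrite (monalgE f).
apply: (big_ind P) => // [u v Pu Pv|x _]; first by rewrite -[u]scale1r; apply: PD.
have -> : << f@_x *g x >> = f@_x *: << x >> + 0 :> {malg K[G]}.
  apply/malgP=> y; rewrite addr0 mcoeffZ !mcoeffU.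
  by case: eqP => //; rewrite ?mulr1n ?mulr0n ?mulr1 ?mulr0.
exact: PD.
Qed.

End LinearExtension.

Lemma linear_swap (K : comNzRingType) (V : lmodType K) (a b : K) (u v w z : V) :
  b *: (a *: u + v) + (a *: w + z) = a *: (b *: u + w) + (b *: v + z).
Proof. by rewrite !scalerDr !scalerA [b * a]mulrC addrACA. Qed.

(** * The convolution product and its ring laws *)

Section GroupAlgebraLaws.
Variables (K : comNzRingType) (G : zmodType).

Implicit Types f g h : {malg K[G]}.

Definition mgelt (x : G) : {malg K[G]} := << x >>.

Definition gmul f g : {malg K[G]} := linext (fun x => linext (fun y => mgelt (x + y)) g) f.

Lemma gmulDl a f1 f2 g : gmul (a *: f1 + f2) g = a *: gmul f1 g + gmul f2 g.
Proof. exact: linearP. Qed.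

Lemma gmul0l g : gmul 0 g = 0. Proof. exact: linear0. Qed.

Lemma gmulUl x g : gmul (mgelt x) g = linext (fun y => mgelt (x + y)) g.
Proof. exact: linextU. Qed.

Lemma gmulUU x y : gmul (mgelt x) (mgelt y) = mgelt (x + y).
Proof. by rewrite gmulUl linextU. Qed.

Lemma gmul0r f : gmul f 0 = 0.
Proof.
by elim/malg_ind: f => [|a f g IHf IHg|x]; rewrite ?gmul0l // ?gmulDl ?IHf ?IHg
  ?scaler0 ?addr0 // gmulUl linear0.
Qed.

Lemma gmulDr a f g1 g2 : gmul f (a *: g1 + g2) = a *: gmul f g1 + gmul f g2.
Proof.
elim/malg_ind: f => [|b f g IHf IHg|x].
- by rewrite !gmul0l scaler0 addr0.
- rewrite gmulDl IHf IHg !gmulDl. 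
exact: (@linear_swap K {malg K[G]} a b (gmul f g1) (gmul f g2) (gmul g g1) (gmul g g2)).
- by rewrite !gmulUl linearP.
Qed.

Lemma gmulC : commutative gmul.
Proof.
move=> f g; elim/malg_ind: f => [|a f1 f2 IH1 IH2|x].
- by rewrite gmul0l gmul0r.
- by rewrite gmulDl gmulDr IH1 IH2.
elim/malg_ind: g => [|a f1 f2 IH1 IH2|y].
- by rewrite gmul0l gmul0r.
- by rewrite gmulDl gmulDr IH1 IH2.
by rewrite !gmulUU addrC.
Qed.

Lemma gmulA : associative gmul.
Proof.
move=> f g h; elim/malg_ind: f => [|a f1 f2 IH1 IH2|x].
- by rewrite !gmul0l.
- by rewrite !gmulDl IH1 IH2.
elim/malg_ind: g => [|a f1 f2 IH1 IH2|y].
- by rewrite !(gmul0l, gmul0r).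
- by rewrite !(gmulDl, gmulDr) IH1 IH2.
elim/malg_ind: h => [|a f1 f2 IH1 IH2|z].
- by rewrite !gmul0r.
- by rewrite !gmulDr IH1 IH2.
by rewrite !gmulUU addrA.
Qed.

Lemma gmul1 : left_id (mgelt 0) gmul.
Proof.
elim/malg_ind => [|a f1 f2 IH1 IH2|x]; first exact: gmul0r.
- by rewrite gmulDr IH1 IH2.
by rewrite gmulUU add0r.
Qed.

Lemma gmulD : left_distributive gmul +%R.
Proof. by move=> f g h; rewrite -[f in LHS]scale1r gmulDl scale1r. Qed.

Lemma gone_neq0 : mgelt 0 != 0.
Proof.
by apply/eqP=> /malgP/(_ 0)/eqP; rewrite mcoeffUU mcoeff0 oner_eq0.
Qed.

End GroupAlgebraLaws.

Section MalgGroupAlgebra.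
Variables (K : comNzRingType) (G : zmodType).

Definition gmalg := {malg K[G]}.
HB.instance Definition _ := GRing.Lmodule.on gmalg.
HB.instance Definition _ := GRing.Zmodule_isComNzRing.Build gmalg
  (@gmulA K G) (@gmulC K G) (@gmul1 K G) (@gmulD K G) (gone_neq0 K G).

Lemma gscaleAl a (f g : gmalg) : a *: (f * g) = (a *: f) * g.
Proof. have := gmulDl a f 0 g; rewrite gmul0l !addr0 => E; exact: esym E. Qed.

HB.instance Definition _ := GRing.Lmodule_isLalgebra.Build K gmalg gscaleAl.
HB.instance Definition _ := GRing.Lalgebra_isComAlgebra.Build K gmalg.

End MalgGroupAlgebra.

(* Reasoning over an abstract carrier keeps unification from unfolding the
   canonical instances of [gmalg]. *)
Record group_algebra (K : comNzRingType) (G : zmodType) := GroupAlgebra {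
  ga_sort :> comAlgType K;
  gelt : G -> ga_sort;
  coef : G -> ga_sort -> K;
  supp : ga_sort -> seq G;
  glift : (G -> ga_sort) -> ga_sort -> ga_sort;
  gelt0 : gelt 0 = 1;
  geltD : forall x y, gelt (x + y) = gelt x * gelt y;
  coef_linear : forall x, linear (coef x : ga_sort -> K^o);
  coef_gelt : forall x y, coef y (gelt x) = (x == y)%:R;
  coefP : forall f g, (forall x, coef x f = coef x g) <-> f = g;
  mem_supp : forall f x, (x \in supp f) = (coef x f != 0);
  supp_uniq : forall f, uniq (supp f);
  glift_linear : forall h, linear (glift h);
  glift_gelt : forall h x, glift h (gelt x) = h x;
  galg_ind : forall P : ga_sort -> Prop,
    P 0 -> (forall a f g, P f -> P g -> P (a *: f + g)) ->
    (forall x, P (gelt x)) -> forall f, P f }.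

Arguments gelt {K G} A x : rename.
Arguments coef {K G A} x f : rename.
Arguments supp {K G A} f : rename.
Arguments glift {K G A} h f : rename.

Lemma galg (K : comNzRingType) (G : zmodType) : group_algebra K G.
Proof.
have lc (x : G) : linear (mcoeff x : gmalg K G -> K^o).
  by move=> a f g; rewrite mcoeffD mcoeffZ.
refine (@GroupAlgebra K G (gmalg K G : comAlgType K) (@mgelt K G)
  (fun x f => mcoeff x f) (fun f => msupp f) (fun h f => linext h f)
  _ _ lc _ _ _ _ _ _ _).
- by [].
- by move=> x y; exact: esym (gmulUU K x y).
- by move=> x y; exact: mcoeffU.
- by move=> f g; exact: malgP.
- by move=> f x; rewrite mcoeff_neq0.
- by move=> f; exact: fset_uniq.
- by move=> h; exact: linextP.
- by move=> h x; exact: linextU.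
- exact: malg_ind.
Qed.

(** * Coefficients, linear extension and sums of group elements *)

Section GroupAlgebra.
Variables (K : comNzRingType) (G : zmodType) (A : group_algebra K G).
Implicit Types (f g : A) (h : G -> A).

Lemma coefZD a f g x : coef x (a *: f + g) = a * coef x f + coef x g.
Proof. exact: coef_linear. Qed.
Lemma coefD f g x : coef x (f + g) = coef x f + coef x g.
Proof. by rewrite -[f in LHS]scale1r coefZD mul1r. Qed.
Lemma coef0 x : coef x (0 : A) = 0.
Proof. by apply: (addrI (coef x (0 : A))); rewrite -coefD !addr0. Qed.
Lemma coefZ a f x : coef x (a *: f) = a * coef x f.
Proof. by rewrite -[a *: f]addr0 coefZD coef0 addr0. Qed.
Lemma coefB f g x : coef x (f - g) = coef x f - coef x g.
Proof. by rewrite -scaleN1r coefD coefZ mulN1r. Qed.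
Lemma coef_sum (I : Type) (r : seq I) (P : pred I) (E : I -> A) x :
  coef x (\sum_(i <- r | P i) E i) = \sum_(i <- r | P i) coef x (E i).
Proof. exact: (big_morph (coef x) (fun f g => coefD f g x) (coef0 x)). Qed.

Lemma glift0 h : glift h 0 = 0 :> A.
Proof.
have := glift_linear h 1 0 0; rewrite !scale1r !addr0 => e.
by apply: (addrI (glift h 0)); rewrite -e addr0.
Qed.
Lemma gliftD h f g : glift h (f + g) = glift h f + glift h g.
Proof. by rewrite -[f in LHS]scale1r glift_linear scale1r. Qed.
Lemma gliftZ h a f : glift h (a *: f) = a *: glift h f.
Proof. by rewrite -[a *: f]addr0 glift_linear glift0 addr0. Qed.
Lemma glift_sum h (I : Type) (r : seq I) (P : pred I) (E : I -> A) :
  glift h (\sum_(i <- r | P i) E i) = \sum_(i <- r | P i) glift h (E i).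
Proof. exact: (big_morph (glift h) (gliftD h) (glift0 h)). Qed.

Lemma geltX x n : gelt A (x *+ n) = gelt A x ^+ n.
Proof. by elim: n => [|n IH]; rewrite ?gelt0 // mulrS exprS geltD IH. Qed.

Lemma coef_geltM x f y : coef (x + y) (gelt A x * f) = coef y f.
Proof.
elim/galg_ind: f => [|a f1 f2 IH1 IH2|z]; first by rewrite mulr0 !coef0.
- by rewrite mulrDr -scalerAr !coefD !coefZ IH1 IH2.
by rewrite -geltD !coef_gelt (inj_eq (addrI x)).
Qed.

Definition gsum (s : seq G) : A := \sum_(x <- s) gelt A x.

Lemma coef_gsum s x : coef x (gsum s) = (count_mem x s)%:R.
Proof.
rewrite /gsum coef_sum; elim: s => [|y s IH]; first by rewrite big_nil.
by rewrite big_cons IH coef_gelt natrD.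
Qed.

Lemma coef_gsumM s f x : coef x (gsum s * f) = \sum_(c <- s) coef (x - c) f.
Proof.
rewrite mulr_suml coef_sum; apply: eq_bigr => c _ /=.
by rewrite -{1}(subrKC c x) coef_geltM.
Qed.

Lemma galg_pchar q : q \in [pchar K] -> q \in [pchar A].
Proof.
move=> /andP[qpr /eqP q0]; rewrite inE qpr /=.
by rewrite -scaler_nat q0 scale0r.
Qed.

(** In characteristic [q] the Frobenius map is additive, so the power can be taken term by term. *)
Lemma gsumXq q s : q \in [pchar K] -> gsum s ^+ q = \sum_(x <- s) gelt A (x *+ q).
Proof.
move=> /galg_pchar qc; rewrite -(pFrobenius_autE qc) rmorph_sum /=.
by apply: eq_bigr => x _; rewrite pFrobenius_autE geltX.
Qed.

End GroupAlgebra.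

(** * Class functions of a Schur ring *)

Lemma sum_nat_seq (T : Type) (P : pred T) (s : seq T) :
  \sum_(c <- s) (P c : nat) = count P s.
Proof. by elim: s => [|c s IH]; rewrite ?big_nil // big_cons IH. Qed.

Section SchurRing.
Variables (F : fieldType) (p : nat) (cls : grp p -> seq (grp p)).
Hypotheses (F0 : [pchar F] =i pred0) (hS : is_schur_ring F cls).
Local Notation G := (grp p).
Implicit Types x y z : G.

Lemma cls_refl x : x \in cls x. Proof. exact: sr_refl hS x. Qed.

Lemma cls_eq x y : y \in cls x -> cls y =i cls x. Proof. exact: (sr_class hS). Qed.

Lemma cls_sym x y : (y \in cls x) = (x \in cls y).
Proof. by apply/idP/idP => /cls_eq ->; apply: cls_refl. Qed.

Lemma mem_cls x y z : y \in cls x -> (y \in cls z) = (x \in cls z).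
Proof. by move=> yx; rewrite cls_sym (cls_eq yx) cls_sym. Qed.

Lemma cls0 x : (x \in cls 0) = (x == 0).
Proof. by apply/idP/eqP => [/(sr_one hS)|->]; last exact: cls_refl. Qed.

Lemma clsN x y : (y \in cls (- x)) = (- y \in cls x).
Proof.
by apply/idP/idP => [/(sr_inv hS)|/(sr_inv hS)]; rewrite opprK.
Qed.

Lemma natr_inj0 (m n : nat) : m%:R = n%:R :> F -> m = n.
Proof.
move/pcharf0P: F0 => F0'.
wlog le_mn : m n / (m <= n)%N => [IH|] e.
  by case/orP: (leq_total m n) => /IH -> //.
have /eqP : (n - m)%:R = 0 :> F by rewrite natrB // e subrr.
by rewrite F0' => /eqP; lia.
Qed.

(** These counts are the coefficients of a product of two class sums, hence constant on classes as
    elements of [F]; characteristic 0 makes the natural numbers equal, so the fact can be used over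
    any coefficient ring. *)
Lemma cls_count x y w z : z \in cls w ->
  count (fun c => z - c \in cls y) (cls x) = count (fun c => w - c \in cls y) (cls x).
Proof.
move=> zw; apply: natr_inj0; have [n [e [lam E]]] := sr_mul hS x y.
rewrite !E; apply: eq_bigr => i _; congr (_ * _%:R).
by rewrite (mem_cls _ zw).
Qed.

(** The product of the class sums of [x] and [y] has a positive count at [x + y], hence at every
    element of that class. This is the main tool for confining a class. *)
Lemma cls_add x y z : z \in cls (x + y) ->
  exists x' y', [/\ x' \in cls x, y' \in cls y & z = x' + y'].
Proof.
move=> /(cls_count x y) E.
have : has (fun c => z - c \in cls y) (cls x).
  rewrite has_count E -has_count; apply/hasP; exists x; first exact: cls_refl.
  by rewrite addrC addKr cls_refl.
case/hasP=> c cx cy; exists c, (z - c); split=> //.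
by rewrite addrC subrK.
Qed.

Section Classwise.
Variables (K : comNzRingType) (A : group_algebra K G).
Implicit Types f g : A.

(** The Schur ring with coefficients in [K]; it is used over prime fields and over the integers. *)
Definition classwise f := forall x y, y \in cls x -> coef y f = coef x f.

Lemma coef_cls x y : coef y (gsum A (cls x)) = (y \in cls x)%:R.
Proof. by rewrite coef_gsum count_uniq_mem // (sr_uniq hS). Qed.

Lemma classwise_cls x : classwise (gsum A (cls x)).
Proof. by move=> y z zy; rewrite !coef_cls (mem_cls _ zy). Qed.

Lemma classwise0 : classwise 0.
Proof. by move=> x y _; rewrite !coef0. Qed.

Lemma classwise_linear a f g : classwise f -> classwise g -> classwise (a *: f + g).
Proof. by move=> Sf Sg x y xy; rewrite !coefD !coefZ (Sf _ _ xy) (Sg _ _ xy). Qed.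

(** Class sums span: subtracting [coef x f] times the class sum of a support point [x] removes [x]
    from the support and adds no new point. *)
Lemma classwise_ind (P : A -> Prop) : P 0 ->
  (forall a x f, P f -> P (a *: gsum A (cls x) + f)) -> forall f, classwise f -> P f.
Proof.
move=> P0 PD f; have [n] := ubnP (size (supp f)); elim: n f => // n IH f lt_n Sf.
case ef: (supp f) => [|x s].
  suff -> : f = 0 by [].
  apply/coefP => x; rewrite coef0; apply/eqP.
  by apply/negPn; rewrite -mem_supp ef.
have xf : x \in supp f by rewrite ef mem_head.
pose g := f - coef x f *: gsum A (cls x).
have gx : coef x g = 0 by rewrite coefB coefZ coef_cls cls_refl mulr1 subrr.
have -> : f = coef x f *: gsum A (cls x) + g by rewrite /g addrC subrK.
apply: PD; apply: IH; last first.
  by rewrite /g addrC -scaleNr; apply: classwise_linear => //; apply: classwise_cls.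
rewrite ltnS in lt_n; apply: leq_trans lt_n.
change (size (x :: supp g) <= size (supp f))%N.
apply: uniq_leq_size => [|y].
  by rewrite /= supp_uniq mem_supp gx eqxx.
rewrite inE => /orP[/eqP -> //|]; rewrite !mem_supp.
apply: contraNN => /eqP fy; rewrite coefB coefZ coef_cls fy.
have [yx|_] := boolP (y \in cls x); last by rewrite mulr0 subrr.
by rewrite -(Sf _ _ yx) fy mul0r subrr.
Qed.

Lemma classwise_clsM x y : classwise (gsum A (cls x) * gsum A (cls y)).
Proof.
move=> w z zw; rewrite !coef_gsumM.
under eq_bigr do rewrite coef_cls.
under [RHS]eq_bigr do rewrite coef_cls.
by rewrite -!natr_sum !sum_nat_seq (cls_count x y zw).
Qed.

Lemma classwise_mul f g : classwise f -> classwise g -> classwise (f * g).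
Proof.
move=> Sf Sg; elim/classwise_ind: Sf => [|a x {}f IHf].
  by rewrite mul0r; apply: classwise0.
rewrite mulrDl -scalerAl; apply: classwise_linear => //.
elim/classwise_ind: Sg {IHf} => [|b y {}g IHg].
  by rewrite mulr0; apply: classwise0.
rewrite mulrDr -scalerAr; apply: classwise_linear => //; exact: classwise_clsM.
Qed.

Lemma classwise1 : classwise 1.
Proof.
move=> x y xy; rewrite -gelt0 !coef_gelt ![0 == _]eq_sym -!cls0.
by rewrite (mem_cls _ xy).
Qed.

Lemma classwise_exp f n : classwise f -> classwise (f ^+ n).
Proof.
move=> Sf; elim: n => [|n IH]; first exact: classwise1.
by rewrite exprS; apply: classwise_mul.
Qed.

End Classwise.

(** Modulo [q], the [q]-th power of the class sum of [x] is the sum of the [c *+ q], and it is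
    constant on classes. By injectivity its coefficient at [x *+ q] is 1, so it is nonzero at
    [y]. *)
Lemma cls_mulp q x y : prime q -> {in cls x &, injective (fun c => c *+ q)} ->
  y \in cls (x *+ q) -> exists2 x', x' \in cls x & y = x' *+ q.
Proof.
move=> q_pr inj yx; have qc := pchar_Fp q_pr.
have /(_ _ _ yx) := classwise_exp q (@classwise_cls _ (galg 'F_q G) x).
rewrite gsumXq // !coef_sum.
under eq_bigr do rewrite coef_gelt.
under [RHS]eq_bigr do rewrite coef_gelt.
rewrite -!natr_sum !sum_nat_seq.
have -> : count (fun c => c *+ q == x *+ q) (cls x) = 1%N.
  rewrite -(eq_in_count (a1 := pred1 x)) => [|c cx /=].
    by rewrite count_uniq_mem ?cls_refl //; apply: (sr_uniq hS).
  by apply/eqP/eqP => [->//|/inj]; apply=> //; apply: cls_refl.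
move=> e; have : has (fun c => c *+ q == y) (cls x).
  rewrite has_count lt0n; apply/eqP => e0; move: e; rewrite e0 => /esym/eqP.
  by rewrite oner_eq0.
by case/hasP=> c cx /eqP <-; exists c.
Qed.

(** Induction over the prime factors of [m]. The set [P] allows two uses: the whole group with [m]
    prime to [p], and the torsion-free <z^p> with any positive [m]. *)
Lemma cls_muln_in (P : pred G) m x y :
  (forall x y, P x -> y \in cls x -> P y) ->
  (forall x n, P x -> P (x *+ n)) ->
  (forall q, prime q -> q %| m -> {in P &, injective (fun c => c *+ q)})%N ->
  (0 < m)%N -> P x -> y \in cls (x *+ m) ->
  exists2 x', x' \in cls x & y = x' *+ m.
Proof.
move=> Pcls Pmul; have [n] := ubnP m; elim: n m x y => // n IH m x y lt_mn inj m0 Px.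
have [m1|m1] := leqP m 1.
  have -> : m = 1%N by lia.
  by move=> yx; exists y.
have q_pr := pdiv_prime m1; set q := pdiv m in q_pr *.
have dq : (q %| m)%N := pdiv_dvd m.
have em : m = ((m %/ q) * q)%N by rewrite divnK.
have q2 := prime_gt1 q_pr.
have lt_m' : (m %/ q < m)%N by rewrite ltn_Pdiv.
have m'0 : (0 < m %/ q)%N by rewrite divn_gt0 ?prime_gt0 // dvdn_leq.
rewrite {1}em mulrnA => /(cls_mulp q_pr) [|z zx ->].
  by move=> u v /(Pcls _ _ (Pmul _ _ Px)) Pu /(Pcls _ _ (Pmul _ _ Px)) Pv; apply: inj.
have [||x' x'x ->] := IH _ x z _ _ m'0 Px zx.
- by apply: leq_trans lt_m' _.
- by move=> r r_pr rd; apply: inj => //; apply: dvdn_trans rd _; apply: dvdn_div.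
by exists x' => //; rewrite -mulrnA -em.
Qed.

End SchurRing.

(** * Levels *)

Lemma absz_eq (a b : int) : `|a|%N = `|b|%N -> a = b \/ a = - b.
Proof. lia. Qed.

Section Grp.
Variable p : nat.
Implicit Types x y : grp p.

Lemma fstD x y : (x + y).1 = x.1 + y.1. Proof. by []. Qed.
Lemma sndD x y : (x + y).2 = x.2 + y.2. Proof. by []. Qed.
Lemma fstN x : (- x).1 = - x.1. Proof. by []. Qed.
Lemma sndN x : (- x).2 = - x.2. Proof. by []. Qed.

Lemma fstMn x n : (x *+ n).1 = x.1 * n%:Z.
Proof. by elim: n => [|n IH]; rewrite ?mulr0 // mulrS fstD IH intS mulrDr mulr1. Qed.

Lemma sndMn x n : (x *+ n).2 = x.2 *+ n.
Proof. by elim: n => [|n IH] //; rewrite !mulrS sndD IH. Qed.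

Lemma grp_eq x y : x.1 = y.1 -> x.2 = y.2 -> x = y.
Proof. by case: x y => [? ?] [? ?] /= -> ->. Qed.

Lemma fstMz x (n : int) : (x *~ n).1 = x.1 * n.
Proof.
case: n => n; first exact: fstMn.
by rewrite NegzE mulrNz fstN -pmulrn fstMn mulrN.
Qed.

Lemma sndMz x (k : int) : (x *~ k).2 = x.2 * k%:~R.
Proof.
rewrite mulrzr; case: k => n; first exact: sndMn.
by rewrite NegzE !mulrNz sndN; congr (- _); apply: sndMn.
Qed.

Lemma zp_subP x : reflect (exists k : int, x = (k * p%:Z, 0)) (zp_sub x).
Proof.
apply: (iffP andP) => [[/dvdzP[k e] /eqP e0]|[k ->]].
  by exists k; apply: grp_eq.
by rewrite dvdz_mull.
Qed.

Hypothesis p_pr : prime p.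

Lemma Zp_p0 : p%:R = 0 :> 'Z_p.
Proof. by rewrite pchar_Zp ?prime_gt1. Qed.

Lemma Zp_mulp (a : 'Z_p) : a *+ p = 0.
Proof. by rewrite -mulr_natr Zp_p0 mulr0. Qed.

Lemma Zp_unit_nat m : coprime m p -> (m%:R : 'Z_p) \is a GRing.unit.
Proof. by rewrite unitZpE ?prime_gt1 // coprime_sym. Qed.

Lemma Zp_unit_int (k : int) : ~~ (p%:Z %| k)%Z ->
  (k%:~R : 'Z_p) \is a GRing.unit.
Proof.
have U n : ~~ (p %| n)%N -> (n%:R : 'Z_p) \is a GRing.unit.
  by move=> nd; apply: Zp_unit_nat; rewrite // coprime_sym prime_coprime.
by rewrite dvdzE; case: k => n; [apply: U|rewrite NegzE mulrNz unitrN => /U].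
Qed.

Lemma Zp_unit (a : 'Z_p) : (a \is a GRing.unit) = (a != 0).
Proof.
have p1 := prime_gt1 p_pr; apply/idP/idP => [|a0].
  by apply: contraTneq => ->; rewrite unitr0.
rewrite -[a]natr_Zp; apply: Zp_unit_nat; rewrite coprime_sym prime_coprime //.
apply: contraNN a0 => /dvdnP[k e].
by rewrite -[a]natr_Zp e natrM Zp_p0 mulr0.
Qed.

Lemma mulp_inj_grp m : coprime m p -> injective (fun x : grp p => x *+ m).
Proof.
move=> co x y e; have m0 : m%:Z != 0.
  by apply/eqP=> e0; move: co; have -> : m = 0%N by [lia]; rewrite /coprime gcd0n;
    have := prime_gt1 p_pr; lia.
apply: grp_eq.
  by have := congr1 fst e; rewrite !fstMn; apply: mulIf.
have := congr1 snd e; rewrite !sndMn -[x.2 *+ m]mulr_natr -[y.2 *+ m]mulr_natr.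
by move=> e2; apply: (mulIr (Zp_unit_nat co)).
Qed.

End Grp.

Section Levels.
Variables (F : fieldType) (p : nat) (cls : grp p -> seq (grp p)).
Hypotheses (p_pr : prime p) (F0 : [pchar F] =i pred0) (hS : is_schur_ring F cls).
Hypothesis hH : is_S_subgroup cls (@zp_sub p).
Local Notation G := (grp p).
Implicit Types x y z : G.

Lemma cls_muln m x y : coprime m p -> y \in cls (x *+ m) ->
  exists2 x', x' \in cls x & y = x' *+ m.
Proof.
move=> co; apply: (cls_muln_in F0 hS (P := predT)) => //.
  move=> q _ dq u v _ _; apply: mulp_inj_grp => //.
  exact: coprime_dvdl dq co.
by rewrite lt0n; apply: contraTneq co => ->; rewrite /coprime gcd0n;
    have := prime_gt1 p_pr; lia.
Qed.

Lemma cls_muln_sub m x y : (0 < m)%N -> zp_sub x -> y \in cls (x *+ m) ->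
  exists2 x', x' \in cls x & y = x' *+ m.
Proof.
move=> m0; apply: (cls_muln_in F0 hS (P := @zp_sub p)) => //.
- by move=> u n /zp_subP[k ->]; apply/zp_subP; exists (k * n%:Z);
    apply: grp_eq; rewrite ?fstMn ?sndMn ?mul0rn //=; ring.
move=> q q_pr _ _ _ /zp_subP[k ->] /zp_subP[l ->] e.
apply: grp_eq => //; have := congr1 fst e; rewrite !fstMn.
by apply: mulIf; have := prime_gt0 q_pr; lia.
Qed.

(** A nonzero [y] is [|l|] times a generator of <z^p>, so every element of its class, in particular
    [x], is [|l|] times an element of <z^p>. *)
Lemma dvd_cls_sub x y : zp_sub x -> y \in cls x -> (y.1 %| x.1)%Z.
Proof.
move=> Hx yx; have [l ey] := zp_subP _ (hH Hx yx).
rewrite (cls_sym hS) in yx.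
have [l0|l0] := eqVneq l 0.
  move: yx; rewrite ey l0 mul0r (cls0 hS) => /eqP ->.
  by rewrite dvdz0.
pose u : G := (sgz l * p%:Z, 0).
have Hu : zp_sub u by apply/zp_subP; exists (sgz l).
have eyu : y = u *+ `|l|%N.
  rewrite ey; apply: grp_eq; rewrite ?fstMn ?sndMn ?mul0rn //=.
  by rewrite {1}[l]intEsg; ring.
rewrite eyu in yx; have [|v vu ->] := cls_muln_sub _ Hu yx; first by lia.
have [k ->] := zp_subP _ (hH Hu vu); rewrite fstMn /= ey /=.
by apply/dvdzP; exists (k * sgz l); rewrite abszEsg; ring.
Qed.

(** As [y.1] is invertible modulo [p], [y] is [|y.1|] times an element of level 1 or -1, and its
    class consists of multiples of [|y.1|]. *)
Lemma dvd_cls x y : ~~ (p%:Z %| y.1)%Z -> y \in cls x -> (y.1 %| x.1)%Z.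
Proof.
move=> py; rewrite (cls_sym hS).
have co : coprime `|y.1| p by rewrite coprime_sym prime_coprime // -dvdzE.
have U := Zp_unit_nat p_pr co.
pose u : G := (sgz y.1, y.2 / (`|y.1|%N)%:R).
have ey : y = u *+ `|y.1|%N.
  apply: grp_eq; rewrite ?fstMn ?sndMn /=; first exact: intEsg.
  by rewrite -[RHS]mulr_natr divrK.
rewrite {1}ey => /(cls_muln co)[v _ ->]; rewrite fstMn.
by apply/dvdzP; exists (v.1 * sgz y.1); rewrite abszEsg; ring.
Qed.

Lemma cls_level0 x y : x.1 = 0 -> y \in cls x -> y.1 = 0.
Proof.
(* Being 1 modulo [p], [m] fixes the torsion element [x], so [y] is an [m]-fold multiple; being
   larger than [|y.1|], it forces level 0. *)
move=> x0; pose m := (1 + p * `|y.1|)%N.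
have co : coprime m p by rewrite coprime_sym /coprime /m addnC mulnC gcdnMDl gcdn1.
have {1}-> : x = x *+ m.
  apply: grp_eq; rewrite ?fstMn ?sndMn ?x0 //.
  by rewrite /m mulrnDr mulrnA Zp_mulp // mul0rn addr0.
case/(cls_muln co) => v _ e; have /(congr1 absz) := congr1 fst e.
rewrite fstMn abszM /= /m => e1; apply/eqP; rewrite -absz_eq0; apply/eqP.
case: (absz v.1) e1 => [|k] e1; first by rewrite e1.
by move: (`|y.1|%N) e1 (prime_gt1 p_pr) => n; nia.
Qed.

(** Splitting off the torsion part of [x] leaves an element [u] of <z^p> whose level and that of [x]
    divide each other. *)
Lemma cls_levelp x y : (p%:Z %| x.1)%Z -> y \in cls x -> y.1 = x.1 \/ y.1 = - x.1.
Proof.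
move=> px; have ex : x = (x.1, 0) + (0, x.2).
  by apply: grp_eq; rewrite /= ?addr0 ?add0r.
rewrite {1}ex => /(cls_add F0 hS)[u [v [ux vx ->]]].
have Hx : zp_sub ((x.1, 0) : G) by rewrite /zp_sub /= px eqxx.
have Hu := hH Hx ux; have d1 := dvd_cls_sub Hx ux.
have d2 : (x.1 %| u.1)%Z by have := @dvd_cls_sub u (x.1, 0) Hu; apply; rewrite (cls_sym hS).
have v0 : v.1 = 0 by apply: cls_level0 vx.
rewrite fstD v0 addr0.
move: d1 d2; rewrite !dvdzE /= => d1 d2; apply/absz_eq/eqP; rewrite eqn_dvd.
by apply/andP; split; [exact: d1|exact: d2].
Qed.

Lemma cls_level x y : y \in cls x -> y.1 = x.1 \/ y.1 = - x.1.
Proof.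
move=> yx; have [|npx] := boolP (p%:Z %| x.1)%Z; first by move/cls_levelp; apply.
have xy : x \in cls y by rewrite (cls_sym hS).
have [py|npy] := boolP (p%:Z %| y.1)%Z.
  by case: (cls_levelp py xy) => ->; rewrite ?opprK; [left|right].
have := dvd_cls npx xy; have := dvd_cls npy yx; rewrite !dvdzE => d1 d2.
by apply/absz_eq/eqP; rewrite eqn_dvd d1.
Qed.

Lemma cls_sub k y : y \in cls (k * p%:Z, 0) -> y = (k * p%:Z, 0) \/ y = - (k * p%:Z, 0).
Proof.
move=> yx; have Hx : zp_sub ((k * p%:Z, 0) : G) by apply/zp_subP; exists k.
have [l e] := zp_subP _ (hH Hx yx).
by case: (cls_level yx); rewrite e /= => ->; [left|right; apply: grp_eq; rewrite /= ?oppr0].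
Qed.

End Levels.

(** * Subgroups generated by a thin class and the torsion *)

Definition tor p (j : 'Z_p) : grp p := (0, j).

Section Tor.
Variable p : nat.
Implicit Types (x y : grp p) (i j : 'Z_p).

Lemma torN j : tor (- j) = - tor j.
Proof. by apply: grp_eq; rewrite /= ?oppr0. Qed.

Lemma torMn j n : tor (j *+ n) = tor j *+ n.
Proof. by apply: grp_eq; rewrite ?fstMn ?sndMn //= mul0r. Qed.

Lemma tor0 : tor 0 = 0 :> grp p. Proof. by []. Qed.

Lemma tor_inj : injective (@tor p). Proof. by move=> i j [->]. Qed.

Lemma torP x : x.1 = 0 -> x = tor x.2.
Proof. by move=> x0; apply: grp_eq. Qed.

Lemma fst_tor x j : (x + tor j).1 = x.1.
Proof. exact: addr0. Qed.

End Tor.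

Section CyclicByTorsion.
Variables (F : fieldType) (p : nat) (cls : grp p -> seq (grp p)).
Hypotheses (p_pr : prime p) (F0 : [pchar F] =i pred0) (hS : is_schur_ring F cls).
Hypothesis hH : is_S_subgroup cls (@zp_sub p).
Local Notation G := (grp p).
Implicit Types (x y z : G) (i j a : 'Z_p) (e : bool).

Variables (r : int) (b bs : G).
Hypotheses (r0 : 0 < r) (b1 : b.1 = r) (bs1 : bs.1 = - r).
Hypothesis hb : forall y, y \in cls b -> y = b \/ y = bs.

(** The class of [b] is only assumed to lie in {[b], [bs]}, so the two values need not share a
    class. *)
Definition flip e : G := if e then bs else b.

Lemma fst_flip e : (flip e).1 = (-1) ^+ e * r.
Proof. by case: e; rewrite /= ?b1 ?bs1 ?expr1 ?expr0 ?mulN1r ?mul1r. Qed.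

Lemma flip_level e (k : int) j : (flip e *~ k + tor j).1 = (-1) ^+ e * (r * k).
Proof. by rewrite fst_tor fstMz fst_flip mulrA. Qed.

Lemma flip_inj e e' (k : int) j j' : k != 0 ->
  flip e *~ k + tor j = flip e' *~ k + tor j' -> e = e' /\ j = j'.
Proof.
move=> k0 E; have := congr1 fst E; rewrite !flip_level => E1.
have ee : e = e' by case: e e' E1 {E} => [] [] //; rewrite ?expr1 ?expr0; nia.
by split=> //; move: E; rewrite ee => /addrI /tor_inj.
Qed.

Lemma cls_mulb (k : int) y : y \in cls (b *~ k) -> exists e, y = flip e *~ k.
Proof.
have hn (n : nat) z : z \in cls (b *~ n) -> exists e, z = flip e *~ n.
  elim: n z => [|n IH] z; first by rewrite mulr0z (cls0 hS) => /eqP ->; exists true.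
  move=> zb; have := cls_level p_pr F0 hS hH zb; move: zb.
  rewrite intS mulrzDr mulr1z => /(cls_add F0 hS)[u [v [ub vb ->]]].
  have [e' ->] := IH _ vb.
  have [e ->] : exists e, u = flip e.
    by case: (hb ub) => ->; [exists false|exists true].
  have [->|n0] := eqVneq n 0%N; first by exists e; rewrite !mulr0z !addr0 mulr1z.
  have [->|] := eqVneq e e'; first by exists e'; rewrite mulrzDr mulr1z.
  (* Opposite signs would give level [(n - 1) r] up to sign, whereas the class lies at [(n + 1) r]
     up to sign. *)
  rewrite !fstD !fstMz !fst_flip b1 => ne.
  by case: e e' ne => [] [] //; rewrite ?expr1 ?expr0; nia.
case: k => n; first exact: hn.
rewrite NegzE mulrNz (clsN hS) => /hn [e E]; exists e.
by rewrite mulrNz -E opprK.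
Qed.

Lemma cls_tor j y : y \in cls (tor j) -> y = tor y.2.
Proof. by move=> yj; apply/torP/(cls_level0 p_pr F0 hS (x := tor j)). Qed.

Lemma cls_mulb_tor (k : int) j y : y \in cls (b *~ k + tor j) ->
  exists e j', y = flip e *~ k + tor j' /\ tor j' \in cls (tor j).
Proof.
move=> /(cls_add F0 hS)[u [v [/cls_mulb[e ->] vj ->]]].
by exists e, v.2; rewrite -(cls_tor vj).
Qed.

Lemma cls_mulb_tor_mem (k : int) e j j' : k != 0 ->
  flip e *~ k + tor j' \in cls (b *~ k + tor j) -> tor j' \in cls (tor j).
Proof.
move=> k0 /cls_mulb_tor[e' [j'' [E]]].
by have [_ ->] := flip_inj k0 E.
Qed.

(* Adding the class of a multiple of b moves any class with nonzero b-coordinate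
   to any other b-coordinate without changing its torsion part. *)
Lemma cls_shift (k l : int) e j j' : 0 < k -> 0 < l ->
  flip e *~ l + tor j' \in cls (b *~ l + tor j) ->
  flip e *~ k + tor j' \in cls (b *~ k + tor j).
Proof.
move=> k0 l0.
have -> : b *~ l + tor j = b *~ k + tor j + b *~ (l - k).
  by rewrite addrAC -mulrzDr subrKC.
case/(cls_add F0 hS) => u [v [uk /cls_mulb[e' ->] E]].
suff -> : flip e *~ k + tor j' = u by [].
have [ee|ne] := eqVneq e e'.
  apply: (addIr (flip e' *~ (l - k))); rewrite -E ee addrAC -mulrzDr.
  by rewrite subrKC.
have [lk|lk] := eqVneq l k.
  by move: E; rewrite lk subrr mulr0z addr0.
(* With opposite signs [u] has level [(2l - k) r] up to sign; agreement with [k r] up to sign would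
   need [l = k] or [l = 0]. *)
have := cls_level p_pr F0 hS hH uk; have := congr1 fst E.
rewrite fstD fstMz flip_level fst_flip fst_tor fstMz b1.
move: (u.1) => u1; case: e e' ne {E} => [] [] // _; rewrite ?expr1 ?expr0; nia.
Qed.

(** Shifting from [b] to its [m]-fold multiple turns [b + tor (j *+ m)] into [m] times [b + tor j],
    where [cls_muln] applies. *)
Lemma cls_scale_sub m e j j' : coprime m p ->
  flip e + tor j' \in cls (b + tor (j *+ m)) ->
  exists2 i, j' = i *+ m & flip e + tor i \in cls (b + tor j).
Proof.
move=> co; have m0 : 0 < m%:Z.
  rewrite ltz_nat lt0n; apply: contraTneq co => ->.
  by rewrite /coprime gcd0n; have := prime_gt1 p_pr; lia.
have := @cls_shift m%:Z 1 e (j *+ m) j' m0 isT; rewrite !mulr1z => H /H.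
rewrite torMn -!pmulrn -mulrnDl => /(cls_muln p_pr F0 hS co)[x' x'b E].
have := @cls_mulb_tor 1 j x'; rewrite mulr1z => /(_ x'b)[e' [i [Ex _]]].
move: E; rewrite Ex mulr1z mulrnDl -torMn !pmulrn => /flip_inj.
case=> [|ee ->]; first by case: m m0 {co H} => //.
by exists i => //; rewrite ee -[flip e']mulr1z -Ex.
Qed.

Lemma cls_scale e a j j' : a != 0 ->
  flip e + tor j' \in cls (b + tor j) ->
  flip e + tor (a * j') \in cls (b + tor (a * j)).
Proof.
rewrite -Zp_unit // => aU.
(* Scaling up by [a] is scaling down by the representative of [a^-1], a natural number prime to
   [p]. *)
have -> : j = (a * j) *+ (a^-1 : 'Z_p).
  by rewrite -mulr_natl natr_Zp mulKr.
have co : coprime (a^-1 : 'Z_p) p.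
  have : (a^-1)%R \is a GRing.unit by rewrite unitrV.
  by rewrite -[X in X \is a _]natr_Zp unitZpE ?prime_gt1 // coprime_sym.
case/(cls_scale_sub co) => i ->.
by rewrite -[i *+ _]mulr_natl -[(a * j) *+ _]mulr_natl !natr_Zp !mulVKr.
Qed.

(** For [a != 0], the automorphism of <b> x Z_p that sends [b] to [flip e] and multiplies torsion by
    [a] keeps each element in its class. *)
Definition stabilizes e a :=
  forall (k : int) j, flip e *~ k + tor (a * j) \in cls (b *~ k + tor j).

(** One membership suffices: [cls_scale] gives the other nonzero [j], [cls_shift] all [k > 0],
    inversion [k < 0], and [k = 0] is read off from the torsion part at [k = 1]. *)
Lemma stabilizesP e a : flip e + tor a \in cls (b + tor 1) ->
  a != 0 /\ stabilizes e a.
Proof.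
move=> ea.
have ta : tor a \in cls (tor 1) by apply: (@cls_mulb_tor_mem 1 e); rewrite ?mulr1z.
have a0 : a != 0.
  apply: contraTneq ta => ->; rewrite (cls_sym hS) (cls0 hS).
  by rewrite -tor0 (inj_eq (@tor_inj p)) oner_eq0.
(* Needed for [j = 0]. If [bs] is not in the class of [b], that class is a singleton, so the class
   of [b + tor 1] stays at level [r] and [e] is false. *)
have eb : flip e \in cls b.
  case: (boolP (bs \in cls b)) => [bsb|nbs]; first by case: (e); rewrite // (cls_refl hS).
  move: ea => /(cls_add F0 hS)[u [v [ub /cls_tor vt E]]].
  have ub' : u = b by case: (hb ub) => // ub'; rewrite -ub' ub in nbs.
  have := congr1 fst E; rewrite vt !fst_tor ub' fst_flip b1.
  by case: (e) => [|_]; [rewrite expr1; lia|exact: (cls_refl hS)].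
have pos (k : int) j : 0 < k -> flip e *~ k + tor (a * j) \in cls (b *~ k + tor j).
  move=> k0; apply: (@cls_shift k 1) => //; rewrite !mulr1z.
  have [->|j0] := eqVneq j 0; first by rewrite mulr0 tor0 !addr0.
  by rewrite mulrC -{2}[j]mulr1; apply: cls_scale.
split=> // k j; case: (ltrgt0P k) => [k0|k0|->]; first exact: pos.
  have := pos (- k) (- j); rewrite oppr_gt0 => /(_ k0).
  by rewrite mulrN !torN !mulrNz -!opprD (clsN hS) opprK.
rewrite !mulr0z !add0r.
have := pos 1 j isT; rewrite !mulr1z => H.
by apply: (@cls_mulb_tor_mem 1 e); rewrite ?mulr1z.
Qed.

(** Positive [k] reduces to 1 by [cls_shift] and nonzero [j] to 1 by [cls_scale], where
    [stabilizesP] applies; negative [k] follows by inversion, and [j = 0] and [k = 0] need their own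
    arguments. *)
Lemma flip_transitive (k : int) j y : y \in cls (b *~ k + tor j) ->
  exists e a, [/\ a != 0, stabilizes e a & y = flip e *~ k + tor (a * j)].
Proof.
have one : flip false + tor 1 \in cls (b + tor 1) by apply: (cls_refl hS).
have [a10 stab1] := stabilizesP one.
have of_cls i i' e : i != 0 -> flip e + tor i' \in cls (b + tor i) ->
    exists2 a, a != 0 /\ stabilizes e a & i' = a * i.
  move=> i0 /(cls_scale (a := i^-1)).
  have iU : i \is a GRing.unit by rewrite Zp_unit.
  rewrite mulVr // => H; exists (i^-1 * i').
    by apply: stabilizesP; apply: H; rewrite -Zp_unit // unitrV.
  by rewrite mulrC mulVKr.
have pos (l : int) i z : 0 < l -> z \in cls (b *~ l + tor i) ->
    exists e a, [/\ a != 0, stabilizes e a & z = flip e *~ l + tor (a * i)].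
  move=> l0 zl; have [e [i' [Ez ti]]] := cls_mulb_tor zl.
  have := @cls_shift 1 l e i i' isT l0; rewrite !mulr1z -Ez => /(_ zl) zb.
  have [i0|i0] := eqVneq i 0; last first.
    by have [a [a0 sa] Ei] := of_cls _ _ _ i0 zb; exists e, a; rewrite -Ei.
  move: ti zb; rewrite i0 tor0 (cls0 hS) -tor0 (inj_eq (@tor_inj p)) => /eqP i'0.
  rewrite i'0 tor0 !addr0 => zb.
  (* For [i = 0] a multiplier compatible with [e] is extracted from [b = (b + tor 1) - tor 1]. *)
  have [a ea] : exists a, flip e + tor a \in cls (b + tor 1).
    have -> : b = (b + tor 1) + tor (- 1) by rewrite torN addrK.
    move: zb; rewrite -{1}[b](addrK (tor 1)) -torN.
    case/(cls_add F0 hS) => u [v [ub /cls_tor vt E]]; exists (- v.2).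
    by rewrite E {1}vt torN addrK torN subrK.
  have [a0 sa] := stabilizesP ea.
  by exists e, a; split=> //; rewrite Ez i'0 mulr0.
case: (ltrgt0P k) => [k0|k0|->]; first exact: pos.
  move=> yk; have := pos (- k) (- j) (- y); rewrite oppr_gt0 => /(_ k0).
  rewrite mulrNz torN -opprD (clsN hS) opprK => /(_ yk)[e [a [a0 sa E]]].
  by exists e, a; split=> //; apply: oppr_inj; rewrite E mulrN torN mulrNz opprD.
rewrite mulr0z add0r => yj; have yt := cls_tor yj.
have [j0|j0] := eqVneq j 0.
  exists false, 1; split=> //; rewrite mulr0z add0r j0 mulr0 tor0.
  by apply/eqP; rewrite -(cls0 hS) -tor0 -j0.
(* Since [y] has level 0, the levels of the two summands cancel; this leaves [flip e + tor i] in the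
   class of [b + tor j] with [y = tor i]. *)
have : y \in cls ((b + tor j) - b) by rewrite addrAC subrr add0r.
case/(cls_add F0 hS) => u [v [ub]]; rewrite (clsN hS).
have := @cls_mulb_tor 1 j u; rewrite mulr1z => /(_ ub)[e [i [Eu _]]].
rewrite mulr1z in Eu => /hb vb E.
have Ev : v = - flip e.
  have := congr1 fst E; rewrite yt Eu fstD fst_tor fst_flip /=.
  rewrite -[v]opprK fstN.
  by case: vb => ->; rewrite ?b1 ?bs1; case: (e) => //; rewrite ?expr1 ?expr0; lia.
have Ey : y = tor i by rewrite E Eu Ev addrAC subrr add0r.
rewrite Eu in ub; have [a [a0 sa] Ei] := of_cls _ _ _ j0 ub.
by exists e, a; split=> //; rewrite mulr0z add0r Ey Ei.
Qed.

End CyclicByTorsion.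

(** * Existence of a thin class *)

Section Expansion.
Variables (K : comNzRingType) (G : zmodType) (A : group_algebra K G).
Implicit Types (f g : A) (x y : G).

Lemma supp_expand f : f = \sum_(x <- supp f) coef x f *: gelt A x.
Proof.
apply/coefP => y; rewrite coef_sum.
under eq_bigr do rewrite coefZ coef_gelt.
have [yf|nyf] := boolP (y \in supp f).
  rewrite (bigD1_seq y) ?supp_uniq //= eqxx mulr1 big1 ?addr0 // => x /negPf xy.
  by rewrite xy mulr0.
rewrite big_seq big1 => [|x xf]; first by apply/eqP; rewrite -[_ == _]negbK -mem_supp.
by case: eqP => [xy|_]; [rewrite -xy xf in nyf|rewrite mulr0].
Qed.

Lemma coefM f g z : coef z (f * g) = \sum_(x <- supp f) coef x f * coef (z - x) g.
Proof.
rewrite {1}(supp_expand f) mulr_suml coef_sum; apply: eq_bigr => x _.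
by rewrite -scalerAl coefZ -{1}(subrKC x z) coef_geltM.
Qed.

Definition pushforward (phi : G -> G) f := glift (fun x => gelt A (phi x)) f.

Lemma coef_pushforward phi f y :
  coef y (pushforward phi f) = \sum_(x <- supp f) coef x f * (phi x == y)%:R.
Proof.
rewrite {1}(supp_expand f) /pushforward glift_sum coef_sum.
by apply: eq_bigr => x _; rewrite gliftZ glift_gelt coefZ coef_gelt.
Qed.

Lemma coef_pushforward_inj phi f x : injective phi ->
  coef (phi x) (pushforward phi f) = coef x f.
Proof.
move=> phi_inj; rewrite coef_pushforward [in RHS](supp_expand f) coef_sum.
by apply: eq_bigr => y _; rewrite coefZ coef_gelt (inj_eq phi_inj).
Qed.

Lemma pushforward_gsum phi s : pushforward phi (gsum A s) = gsum A (map phi s).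
Proof.
by rewrite /gsum /pushforward glift_sum big_map; apply: eq_bigr => x _; rewrite glift_gelt.
Qed.

Lemma pushforwardM phi f g : {morph phi : x y / x + y} ->
  pushforward phi (f * g) = pushforward phi f * pushforward phi g.
Proof.
move=> phiD; rewrite /pushforward.
elim/galg_ind: f => [|a f1 f2 IH1 IH2|x].
- by rewrite mul0r glift0 mul0r.
- by rewrite mulrDl -scalerAl !gliftD !gliftZ IH1 IH2 mulrDl -scalerAl.
elim/galg_ind: g => [|a f1 f2 IH1 IH2|y].
- by rewrite mulr0 glift0 mulr0.
- by rewrite mulrDr -scalerAr !gliftD !gliftZ IH1 IH2 mulrDr -scalerAr.
by rewrite -geltD !glift_gelt phiD geltD.
Qed.

End Expansion.

(** * The derivation attached to an additive map, and logarithmic derivatives *)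

Section Derivation.
Variables (K : comNzRingType) (G : zmodType) (A : group_algebra K G).
Variable d : G -> K.
Hypothesis dD : {morph d : x y / x + y}.
Implicit Types (f g u v : A) (x y : G).

Definition deriv f := glift (fun x => d x *: gelt A x) f.

Lemma coef_deriv f x : coef x (deriv f) = d x * coef x f.
Proof.
rewrite /deriv; elim/galg_ind: f => [|a f1 f2 IH1 IH2|y].
- by rewrite glift0 !coef0 mulr0.
- by rewrite gliftD gliftZ !coefD !coefZ IH1 IH2 mulrDr mulrCA.
rewrite glift_gelt coefZ coef_gelt.
by case: eqP => [->|_]; rewrite ?mulr0.
Qed.

Lemma derivM f g : deriv (f * g) = deriv f * g + f * deriv g.
Proof.
rewrite /deriv; elim/galg_ind: f => [|a f1 f2 IH1 IH2|x].
- by rewrite !(mul0r, glift0) addr0.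
- rewrite !(mulrDl, gliftD) !gliftZ -!scalerAl gliftZ IH1 IH2 scalerDr.
  by rewrite addrACA.
elim/galg_ind: g => [|a f1 f2 IH1 IH2|y].
- by rewrite !(mulr0, glift0) addr0.
- rewrite !(mulrDr, gliftD) !gliftZ -!scalerAr gliftZ IH1 IH2 scalerDr.
  by rewrite addrACA.
by rewrite -geltD !glift_gelt dD -scalerAl -scalerAr -geltD scalerDl.
Qed.

Lemma deriv1 : deriv 1 = 0.
Proof. by apply: (addIr (deriv 1)); rewrite add0r -{3}[1](mulr1 1) derivM mulr1 mul1r. Qed.

Lemma deriv_pushforward phi (m : K) f : (forall x, d (phi x) = m * d x) ->
  deriv (pushforward phi f) = m *: pushforward phi (deriv f).
Proof.
move=> dphi; rewrite /deriv /pushforward; elim/galg_ind: f => [|a f1 f2 IH1 IH2|x].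
- by rewrite !glift0 scaler0.
- by rewrite !(gliftD, gliftZ) IH1 IH2 scalerDr !scalerA mulrC.
by rewrite !glift_gelt gliftZ glift_gelt dphi scalerA.
Qed.

(** [v] plays the role of the logarithmic derivative of [u], stated without division. *)
Definition logderiv u v := deriv u = v * u.

Lemma logderiv1 : logderiv 1 0.
Proof. by rewrite /logderiv deriv1 mul0r. Qed.

Lemma logderivM u u' v v' :
  logderiv u v -> logderiv u' v' -> logderiv (u * u') (v + v').
Proof.
rewrite /logderiv derivM => -> ->.
by rewrite mulrDl -mulrA (mulrCA u v' u').
Qed.

Lemma logderivX u v n : logderiv u v -> logderiv (u ^+ n) (v *+ n).
Proof.
move=> uv; elim: n => [|n IH]; first exact: logderiv1.
by rewrite exprS mulrS; apply: logderivM.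
Qed.

Lemma logderiv_prod (I : finType) (P : pred I) (u v : I -> A) :
  (forall i, logderiv (u i) (v i)) ->
  logderiv (\prod_(i | P i) u i) (\sum_(i | P i) v i).
Proof.
move=> uv; apply: (big_rec2 logderiv) => [|i v' u' _]; first exact: logderiv1.
exact: logderivM.
Qed.

End Derivation.

(** * The grading by levels and leading parts *)

Section LevelSupport.
Variables (K : comNzRingType) (p : nat) (A : group_algebra K (grp p)).
Implicit Types (f g u v : A) (x y : grp p) (P Q R : int -> Prop).

Definition within P f := forall x, coef x f != 0 -> P x.1.

Lemma within_mul P Q R f g : (forall i j, P i -> Q j -> R (i + j)) ->
  within P f -> within Q g -> within R (f * g).
Proof.
move=> PQR Pf Qg z; rewrite coefM.
have [/hasP[x _ xn] _|/hasPn h] := boolP (has (fun x => coef x f * coef (z - x) g != 0) (supp f)).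
  have xf : coef x f != 0 by apply: contraNneq xn => ->; rewrite mul0r.
  have zg : coef (z - x) g != 0 by apply: contraNneq xn => ->; rewrite mulr0.
  by rewrite -(subrKC x z) fstD; apply: PQR; [apply: Pf|apply: Qg].
rewrite big_seq big1 ?eqxx // => x xf; apply/eqP; have := h x xf.
by rewrite negbK.
Qed.

Lemma withinD P f g : within P f -> within P g -> within P (f + g).
Proof.
move=> Pf Pg x; rewrite coefD => n0.
have [e|] := eqVneq (coef x f) 0; last exact: Pf.
by apply: Pg; rewrite e add0r in n0.
Qed.

Lemma within_sub P Q f : (forall i, P i -> Q i) -> within P f -> within Q f.
Proof. by move=> PQ Pf x n0; apply: PQ; apply: Pf. Qed.

Lemma within0 P : within P 0.
Proof. by move=> x; rewrite coef0 eqxx. Qed.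

Lemma within_gelt P x : P x.1 -> within P (gelt A x).
Proof.
move=> Px y; rewrite coef_gelt; case: (eqVneq x y) => [<- //|_].
by rewrite eqxx.
Qed.

Lemma withinZ P a f : within P f -> within P (a *: f).
Proof.
by move=> Pf x; rewrite coefZ => n0; apply: Pf; apply: contraNneq n0 => ->; rewrite mulr0.
Qed.

Lemma within_sum P (I : Type) (r : seq I) (S : pred I) (E : I -> A) :
  (forall i, S i -> within P (E i)) -> within P (\sum_(i <- r | S i) E i).
Proof.
move=> PE; apply: big_ind => //; [exact: within0|exact: withinD].
Qed.

Lemma within_deriv P d f : within P f -> within P (deriv d f).
Proof.
move=> Pf x; rewrite coef_deriv => n0; apply: Pf.
by apply: contraNneq n0 => ->; rewrite mulr0.
Qed.

Lemma within_pushforward P Q phi f : (forall x, P x.1 -> Q (phi x).1) ->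
  within P f -> within Q (pushforward phi f).
Proof.
move=> PQ Pf y; rewrite coef_pushforward.
have [/hasP[x _ xn] _|/hasPn h] :=
  boolP (has (fun x => coef x f * (phi x == y)%:R != 0) (supp f)).
  have xf : coef x f != 0 by apply: contraNneq xn => ->; rewrite mul0r.
  by move: xn; case: (phi x =P y) => [<- _|_]; [apply/PQ/Pf|rewrite mulr0 eqxx].
rewrite big_seq big1 ?eqxx // => x xf; apply/eqP; have := h x xf.
by rewrite negbK.
Qed.

(** [g] is the component of [f] at level [n], and no higher level occurs in [f]. As [g] may vanish,
    [U_neq0] is proved separately. *)
Definition leading (n : int) f g :=
  within (fun i => i = n) g /\ within (fun i => i < n) (f - g).

Lemma leading1 : leading 0 1 1.
Proof.
by split; [rewrite -gelt0; apply: within_gelt|rewrite subrr; apply: within0].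
Qed.

Lemma leadingM m n f g f' g' :
  leading m f g -> leading n f' g' -> leading (m + n) (f * f') (g * g').
Proof.
move=> [gm fm] [gn fn]; split; first by apply: (within_mul _ gm gn) => i j -> ->.
have -> : f * f' - g * g' = (f - g) * (f' - g' + g') + g * (f' - g').
  by rewrite subrK mulrBl mulrBr addrA subrK.
apply: withinD.
  apply: (within_mul (Q := fun i => i <= n) _ fm) => [i j im jn|]; first by lia.
  apply: withinD; [apply: within_sub fn|apply: within_sub gn]; lia.
by apply: (within_mul _ gm fn) => i j -> jn; lia.
Qed.

Lemma leadingX m f g n : leading m f g -> leading (m *+ n) (f ^+ n) (g ^+ n).
Proof.
move=> l; elim: n => [|n IH]; first exact: leading1.
by rewrite mulrS !exprS; apply: leadingM.
Qed.

Lemma leading_prod (I : finType) (P : pred I) (m : I -> int) (f g : I -> A) :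
  (forall i, P i -> leading (m i) (f i) (g i)) ->
  leading (\sum_(i | P i) m i) (\prod_(i | P i) f i) (\prod_(i | P i) g i).
Proof.
move=> l; apply: (big_rec3 leading) => [|i n f' g' Pi]; first exact: leading1.
by apply: leadingM; apply: l.
Qed.

Lemma coef_leading n f g x : leading n f g -> x.1 = n -> coef x f = coef x g.
Proof.
move=> [_ lt] xn; apply/eqP; rewrite -subr_eq0 -coefB; apply: contraT => /lt.
by rewrite xn ltxx.
Qed.

End LevelSupport.

(** * A class with a single element at some level congruent to 1 modulo [p] *)

Section ThinClass.
Variables (F : fieldType) (p : nat) (cls : grp p -> seq (grp p)).
Hypotheses (p_pr : prime p) (F0 : [pchar F] =i pred0) (hS : is_schur_ring F cls).
Hypothesis hH : is_S_subgroup cls (@zp_sub p).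
Local Notation G := (grp p).
Implicit Types (x y : G) (i j a : 'Z_p).

Let x0 : G := (1, 0).
Variable j0 : 'Z_p.
Hypothesis not_full : ((1, j0) : G) \notin cls x0.

Let A := galg 'Z_p G.
Let t := [seq c <- cls x0 | c.1 == 1].
Let sigma a : A -> A := pushforward (fun x : G => x *+ a).
Let D : A -> A := deriv (snd : G -> 'Z_p).
Let X : A := gsum A t.

Let coprime_Zp a : a != 0 -> coprime a p.
Proof.
rewrite -Zp_unit // => aU; have : (a : nat)%:R \is a @GRing.unit 'Z_p by rewrite natr_Zp.
by rewrite unitZpE ?prime_gt1 // coprime_sym.
Qed.

(** The list [t] contains [x0] and misses [(1, j0)], so its size lies strictly between 0 and [p]. *)
Let size_t_unit : ((size t)%:R : 'Z_p) \is a GRing.unit.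
Proof.
have t_gt0 : (0 < size t)%N.
  rewrite size_filter -has_count; apply/hasP; exists x0 => //.
  exact: (cls_refl hS).
have t_lt : (size t < p)%N.
  have ut : uniq (j0 :: map snd t).
    rewrite /= map_inj_in_uniq ?filter_uniq ?(sr_uniq hS) //; last first.
      move=> x y; rewrite !mem_filter => /andP[/eqP ex _] /andP[/eqP ey _] e.
      by apply: grp_eq; rewrite ?ex ?ey.
    rewrite andbT; apply/mapP => -[x]; rewrite mem_filter => /andP[/eqP ex xt] e.
    by move: not_full; have -> : (1, j0) = x by [apply: grp_eq; rewrite ?ex]; rewrite xt.
  have := card_uniqP ut; rewrite /= size_map => <-.
  by apply: leq_trans (max_card _) _; rewrite card_ord Zp_cast ?prime_gt1.
apply: Zp_unit_nat => //; rewrite coprime_sym prime_coprime //.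
by rewrite gtnNdvd.
Qed.

(* The inverse of X, as X ^+ p is a unit multiple of a group element. *)
Let w : A := (size t)%:R^-1 *: (gelt A (- p%:Z, 0) * X ^+ p.-1).

Let Xw : X * w = 1.
Proof.
(* The [p]-th power is termwise and kills torsion, so every term becomes z^p. *)
have Xp : X ^+ p = (size t)%:R *: gelt A (p%:Z, 0).
  rewrite gsumXq ?pchar_Zp ?inE ?p_pr ?Zp_p0 ?eqxx //.
  rewrite scaler_nat -iter_addr_0 -(count_predT t) -big_const_seq !big_seq.
  apply: eq_bigr => c.
  rewrite mem_filter => /andP[/eqP ec _]; congr gelt.
  by apply: grp_eq; rewrite ?fstMn ?sndMn ?Zp_mulp // ec mul1r.
rewrite /w -scalerAr mulrCA -exprS prednK ?prime_gt0 // Xp -scalerAr scalerA.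
rewrite mulVr // scale1r -geltD -gelt0; congr gelt.
by apply: grp_eq; rewrite ?fstD ?sndD /= ?addNr ?addr0.
Qed.

(** The logarithmic derivative of [X]; it sits at level 0, that is, in F_p[Z_p]. *)
Let h : A := D X * w.

Let within_h : within (fun k => k = 0) h.
Proof.
have wX : within (fun k => k = 1) X.
  rewrite /X /gsum big_seq; apply: within_sum => c.
  by rewrite mem_filter => /andP[/eqP ec _]; apply: within_gelt.
have wXn n : within (fun k => k = n%:Z) (X ^+ n).
  elim: n => [|n IH]; first by rewrite expr0 -gelt0; apply: within_gelt.
  by rewrite exprS; apply: (within_mul _ wX IH) => k l -> ->.
apply: (within_mul (P := fun k => k = 1) (Q := fun k => k = - 1)) => [k l -> -> //||].
  exact: within_deriv.
apply: withinZ; apply: (within_mul (P := fun k => k = - p%:Z) _ _ (wXn _)).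
  by move=> k l -> ->; have := prime_gt0 p_pr; lia.
exact: within_gelt.
Qed.

Let sigmaM a f g : sigma a (f * g) = sigma a f * sigma a g.
Proof. by apply: pushforwardM => x y; rewrite mulrnDl. Qed.

Let sigma1 a : sigma a 1 = 1.
Proof. by rewrite -gelt0 /sigma /pushforward glift_gelt mul0rn gelt0. Qed.

Let logderiv_sigma a : logderiv snd (sigma a X) (a *: sigma a h).
Proof.
rewrite /logderiv (deriv_pushforward (m := a)) => [|x]; last first.
  by rewrite sndMn -mulr_natl natr_Zp.
rewrite -scalerAl -/(sigma a h); congr (_ *: _).
by rewrite -sigmaM /h -mulrA [w * X]mulrC Xw mulr1.
Qed.

(** Chosen so that the factor [a] produced by differentiating [sigma a X] becomes -1 in the
    logarithmic derivative of [U]. *)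
Let expo a : nat := (- a^-1)%R.
Let U : A := \prod_(a : 'Z_p | a != 0) sigma a X ^+ expo a.
Let g : A := - \sum_(a : 'Z_p | a != 0) sigma a h.

Let expoE a : a != 0 -> a * (expo a)%:R = - 1.
Proof. by rewrite -Zp_unit // => aU; rewrite /expo natr_Zp mulrN divrr. Qed.

Let logderivU : logderiv snd U g.
Proof.
have -> : g = \sum_(a : 'Z_p | a != 0) (a *: sigma a h) *+ expo a.
  rewrite /g -sumrN; apply: eq_bigr => a a0.
  by rewrite -scaler_nat scalerA mulrC expoE // scaleN1r.
by apply: logderiv_prod => // a; apply: logderivX.
Qed.

Let within_g : within (fun k => k = 0) g.
Proof.
rewrite /g -scaleN1r; apply: withinZ; apply: within_sum => a _.
by apply: within_pushforward within_h => x e; rewrite fstMn e mul0r.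
Qed.

(* The logarithmic derivative of U is, up to sign, a trace over the group of
   multipliers, so it is invariant under them. *)
Let g_const j : j != 0 ->
  coef (tor j) g = - \sum_(a : 'Z_p | a != 0) coef (tor a) h.
Proof.
move=> jn0; have jU : j \is a GRing.unit by rewrite Zp_unit.
have inv (a : 'Z_p) : a != 0 -> j * (j * a^-1)^-1 = a.
  by rewrite -Zp_unit // => aU; rewrite invrM ?unitrV // invrK mulrCA divrr // mulr1.
rewrite /g -sub0r coefB coef0 sub0r coef_sum; congr (- _).
(* The substitution of [j * a^-1] for [a] is an involution of the nonzero residues. *)
rewrite [RHS](reindex_onto (fun a => j * a^-1) (fun a => j * a^-1)) /=; last first.
  by move=> a /inv.
apply: eq_big => a.
  have [->|a0] := eqVneq a 0.
    by rewrite -!Zp_unit // unitrM jU unitrV unitr0.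
  have aU : a \is a GRing.unit by rewrite Zp_unit.
  by rewrite inv // eqxx andbT -Zp_unit // unitrM jU unitrV aU.
move=> a0; have aU : a \is a GRing.unit by rewrite Zp_unit.
have -> : tor j = tor (j * a^-1) *+ a.
  by rewrite -torMn -mulr_natr natr_Zp divrK.
rewrite /sigma (@coef_pushforward_inj _ _ A (fun x : G => x *+ a)) //.
by apply: mulp_inj_grp => //; apply: coprime_Zp.
Qed.

Let n : nat := (\sum_(a : 'Z_p | a != 0%R) a * expo a)%N.

(** The counterpart of [U] built from the whole class of [x0]: it is constant on classes, and [U] is
    its part at the top level [n]. *)
Let Phi : A := \prod_(a : 'Z_p | a != 0) gsum A [seq c *+ a | c <- cls x0] ^+ expo a.

(** The class of [x0] lies at levels 1 and -1, and nonzero residues have positive representatives,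
    so multiplication by [a] keeps the level-1 part on top. *)
Let leading_Phi : leading n%:Z Phi U.
Proof.
have -> : n%:Z = \sum_(a : 'Z_p | a != 0) (a : nat)%:Z *+ expo a.
  rewrite /n (big_morph Posz PoszD (erefl _)); apply: eq_bigr => a _.
  by rewrite -mulr_natr natz PoszM.
apply: leading_prod => a a0; apply: leadingX.
have a_gt0 : 0 < (a : nat)%:Z.
  by rewrite ltz_nat lt0n; apply: contraNneq a0 => e; apply/eqP/val_inj.
have x0lvl c : c \in cls x0 -> c.1 = 1 \/ c.1 = - 1 by apply: (cls_level p_pr F0 hS hH).
rewrite /sigma /X pushforward_gsum; split.
  rewrite /gsum big_map big_seq; apply: within_sum => c.
  rewrite mem_filter => /andP[/eqP ec _]; apply: within_gelt.
  by rewrite fstMn ec mul1r.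
rewrite /gsum !big_map big_filter (bigID (fun c => c.1 == 1)) /= addrC addrK.
rewrite big_seq_cond; apply: within_sum => c /andP[/x0lvl cl c1].
apply: within_gelt; rewrite fstMn; case: cl => e; first by rewrite e eqxx in c1.
by rewrite e; lia.
Qed.

(** Multiplication by [a], which is prime to [p], carries the class of [x0] onto a union of
    classes. *)
Let classwise_Phi : classwise cls Phi.
Proof.
rewrite /Phi; apply: (big_ind (@classwise p cls _ A)) => [||a a0].
- exact: (classwise1 hS).
- exact: (classwise_mul F0 hS).
apply: (classwise_exp F0 hS).
have co := coprime_Zp a0; have inj := mulp_inj_grp p_pr co.
move=> x y yx; rewrite !coef_gsum !count_uniq_mem ?map_inj_uniq ?(sr_uniq hS) //.
congr (_%:R); congr nat_of_bool.
have aux u v : v \in cls u -> u \in [seq c *+ a | c <- cls x0] ->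
    v \in [seq c *+ a | c <- cls x0].
  move=> vu /mapP[c c0 eu]; move: vu; rewrite eu => /(cls_muln p_pr F0 hS co)[c' c'c ->].
  by apply: map_f; rewrite -(cls_eq hS c0).
by apply/idP/idP; apply: aux => //; rewrite (cls_sym hS).
Qed.

(** [U] is a product of powers of units, with an inverse built from [w]. *)
Let U_neq0 : exists j, coef (n%:Z, j) U != 0.
Proof.
apply/existsP; apply: contraT => /existsPn h0.
have U0 : U = 0.
  apply/coefP => x; rewrite coef0; apply/eqP; apply: contraT => xn.
  have [e _] := leading_Phi; have := h0 x.2; rewrite -(e _ xn).
  by rewrite -surjective_pairing xn.
have : U * \prod_(a : 'Z_p | a != 0) sigma a w ^+ expo a = 1.
  rewrite -big_split big1 //= => a _.
  by rewrite -exprMn -sigmaM Xw sigma1 expr1n.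
by rewrite U0 mul0r => /eqP; rewrite eq_sym oner_eq0.
Qed.

(** Comparison of coefficients at level [n] in [D U = g U], where by [g_const] all nontrivial
    torsion elements have the same coefficient in [g]. *)
Let U_recurrence j : let u i := coef (n%:Z, i) U in
  j * u j = (coef (tor 0) g + \sum_(a : 'Z_p | a != 0) coef (tor a) h) * u j
            - (\sum_(a : 'Z_p | a != 0) coef (tor a) h) * \sum_i u i.
Proof.
move=> u; set k := \sum_(a | _) _.
have -> : j * u j = coef (n%:Z, j) (D U) by rewrite coef_deriv.
have gE : g = \sum_i coef (tor i) g *: gelt A (tor i).
  apply/coefP => x; rewrite coef_sum.
  under eq_bigr do rewrite coefZ coef_gelt.
  have [x1|x1] := eqVneq x.1 0.
    rewrite (bigD1 x.2) //= -(torP x1) eqxx mulr1 big1 ?addr0 // => i ix.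
    have [e|_] := eqVneq (tor i) x; last by rewrite mulr0.
    by rewrite -e eqxx in ix.
  rewrite big1 => [|i _].
    by apply/eqP; apply: contraT => /within_g e; rewrite e eqxx in x1.
  have [e|_] := eqVneq (tor i) x; last by rewrite mulr0.
  by rewrite -e eqxx in x1.
have -> : D U = g * U := logderivU.
rewrite {1}gE mulr_suml coef_sum.
have -> : \sum_i u i = \sum_i u (j - i).
  by rewrite (reindex_inj (h := fun i => j - i)) // => i i' /addrI/oppr_inj.
have cg i : coef (n%:Z, j) (coef (tor i) g *: gelt A (tor i) * U)
            = coef (tor i) g * u (j - i).
  rewrite -scalerAl coefZ; congr (_ * _).
  rewrite /u -[in RHS](coef_geltM (tor i)); congr coef.
  by apply: grp_eq; [exact: esym (add0r _)|exact: esym (subrKC i j)].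
under eq_bigr do rewrite cg.
rewrite (bigD1 0) //= [X in _ = _ - _ * X](bigD1 0) //= subr0.
have -> : \sum_(i | i != 0) coef (tor i) g * u (j - i)
          = - (k * \sum_(i | i != 0) u (j - i)).
  rewrite mulr_sumr -sumrN; apply: eq_bigr => i i0.
  by rewrite g_const // mulNr.
by ring.
Qed.

(** The recurrence concentrates [U] at a single [c]. As [Phi] is constant on classes and agrees with
    [U] at level [n], the class of [(n, c)] has no other element at that level. *)
Lemma thin_class : exists (m s : nat) (c : 'Z_p), m = (1 + p * s)%N /\
  forall j, ((m%:Z, j) : G) \in cls (m%:Z, c) -> j = c.
Proof.
pose u i := coef (n%:Z, i) U.
pose k := \sum_(a : 'Z_p | a != 0) coef (tor a) h.
pose c : 'Z_p := coef (tor 0) g + k.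
have rec i : i * u i = c * u i - k * \sum_l u l := U_recurrence i.
(* In the recurrence at [c] itself, the left side cancels the first term on the right. *)
have kS : k * (\sum_i u i) = 0.
  by apply: oppr_inj; apply: (addrI (c * u c)); rewrite -rec oppr0 addr0.
have uc i : i != c -> u i = 0.
  move=> ic; have := rec i; rewrite kS subr0 => e.
  have iU : (i - c) \is a GRing.unit by rewrite Zp_unit // subr_eq0.
  by apply: (mulrI iU); rewrite mulr0 mulrBl e subrr.
have un0 : u c != 0.
  have [j uj] := U_neq0; have [<-//|/uc e] := eqVneq j c.
  by rewrite -/(u j) e eqxx in uj.
(* Each of the [p - 1] summands [a * expo a] is -1 modulo [p]. *)
have n1 : (n%:R : 'Z_p) = 1.
  rewrite /n natr_sum.
  under eq_bigr => a a0 do rewrite natrM natr_Zp expoE //.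
  rewrite sumr_const; set m := #|_|.
  have -> : m = p.-1 by rewrite /m cardC1 card_ord (Zp_cast (prime_gt1 p_pr)).
  by rewrite mulNrn -subn1 natrB ?prime_gt0 // opprB (Zp_p0 p_pr) subr0.
have n_gt0 : (0 < n)%N.
  by rewrite lt0n; apply: contra_eq_neq n1 => ->; rewrite eq_sym oner_eq0.
have /dvdnP[s ns] : (p %| n - 1)%N.
  by rewrite /dvdn -(val_Zp_nat (prime_gt1 p_pr)) natrB // n1 subrr.
exists n, s, c; split; first by lia.
move=> j /classwise_Phi e.
have ej : u j = u c.
  by rewrite /u -!(coef_leading leading_Phi) //.
by apply/eqP; apply: contraT => /uc e0; rewrite -ej e0 eqxx in un0.
Qed.

End ThinClass.

(** * Automorphisms *)

(** Excluded middle enters here because preserving classes is a condition on all elements of an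
    infinite group. *)
Lemma filter_prop (T : eqType) (P : T -> Prop) (s : seq T) :
  exists s' : seq T, forall u : T, (u \in s') <-> (u \in s) /\ P u.
Proof.
elim: s => [|v s [s' IH]]; first by exists [::] => u; split=> // -[].
have [Pv|nPv] := classic (P v).
  exists (v :: s') => u; rewrite !inE; split.
    by case/orP => [/eqP -> //|/IH[us Pu]]; rewrite ?eqxx // us orbT.
  case=> /orP[-> //|us Pu]; apply/orP; right; exact/IH.
exists s' => u; rewrite inE; split; first by case/IH => -> Pu; rewrite orbT.
by case=> /orP[/eqP -> //|us Pu]; apply/IH.
Qed.

Lemma In_map (T : eqType) (U : Type) (f : T -> U) (s : seq T) (v : U) :
  List.In v [seq f u | u <- s] <-> exists2 u, u \in s & f u = v.
Proof.
elim: s => [|u s IH] /=; first by split=> // -[].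
split.
  case=> [<-|/IH[w ws <-]]; first by exists u; rewrite ?mem_head.
  by exists w; rewrite // inE ws orbT.
case=> w; rewrite inE => /orP[/eqP ->|ws] e; [by left|right].
by apply/IH; exists w.
Qed.

(** For prime [p] and [a != 0] these are all the automorphisms of Z x Z_p: [(1, 0)] goes to level 1
    or -1 with torsion part [i], and [(0, 1)] goes to [(0, a)]. *)
Definition haut p (e : bool) (i a : 'Z_p) (x : grp p) : grp p :=
  ((-1) ^+ e * x.1, a * x.2 + i * x.1%:~R).

Section Haut.
Variable p : nat.
Implicit Types (e : bool) (i a : 'Z_p) (x y : grp p).

Lemma fst_haut e i a x : (haut e i a x).1 = (-1) ^+ e * x.1.
Proof. by []. Qed.

Lemma snd_haut e i a x : (haut e i a x).2 = a * x.2 + i * x.1%:~R.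
Proof. by []. Qed.

Lemma hautD e i a : {morph haut e i a : x y / x + y}.
Proof.
move=> x y; apply: grp_eq; rewrite ?fstD ?sndD ?fst_haut ?snd_haut fstD ?sndD.
  by rewrite mulrDr.
by rewrite intrD !mulrDr addrACA.
Qed.

Lemma haut_id : haut false 0 1 =1 (id : grp p -> grp p).
Proof. by move=> x; apply: grp_eq; rewrite /haut /= mul1r // mul0r addr0. Qed.

Lemma haut_comp e i a e' i' a' x :
  haut e i a (haut e' i' a' x) = haut (e (+) e') (a * i' + i * (-1) ^+ e') (a * a') x.
Proof.
apply: grp_eq; rewrite ?fst_haut ?snd_haut ?fst_haut.
  by rewrite mulrA signr_addb.
by rewrite rmorphM /= rmorph_sign; ring.
Qed.

Lemma haut_inv e i a : prime p -> a != 0 ->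
  exists2 i', cancel (haut e i a) (haut e i' a^-1) &
              cancel (haut e i' a^-1) (haut e i a).
Proof.
have ss : (-1) ^+ e * (-1) ^+ e = 1 :> 'Z_p by rewrite -signr_addb addbb.
move=> p_pr; rewrite -Zp_unit // => aU; exists (- (a^-1 * i * (-1) ^+ e)) => x;
  rewrite haut_comp addbb.
  rewrite mulVr // -[RHS]haut_id; congr haut.
  by rewrite mulNr -[a^-1 * i * _ * _]mulrA ss mulr1 subrr.
rewrite mulrV // -[RHS]haut_id; congr haut.
by rewrite mulrN -mulrA mulVKr // addNr.
Qed.

Lemma haut_aut e i a : prime p -> a != 0 -> is_aut (haut e i a).
Proof.
move=> p_pr a0; split; first exact: hautD.
by have [i' K1 K2] := haut_inv e i p_pr a0; exists (haut e i' a^-1).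
Qed.

End Haut.

(** * Class-preserving automorphisms act transitively on each class *)

Section Automorphic.
Variables (F : fieldType) (p : nat) (cls : grp p -> seq (grp p)).
Hypotheses (p_pr : prime p) (F0 : [pchar F] =i pred0) (hS : is_schur_ring F cls).
Hypothesis hH : is_S_subgroup cls (@zp_sub p).
Local Notation G := (grp p).
Implicit Types (x y z : G) (i j a c : 'Z_p) (e : bool).

Definition preserves e i a := a != 0 /\ forall x, haut e i a x \in cls x.

Lemma preserves_comp e i a e' i' a' :
  preserves e i a -> preserves e' i' a' ->
  preserves (e (+) e') (a * i' + i * (-1) ^+ e') (a * a').
Proof.
move=> [a0 h] [a0' h']; split.
  by rewrite -Zp_unit // unitrM !Zp_unit ?a0.
by move=> x; rewrite -haut_comp -(cls_eq hS (h' x)).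
Qed.

(** The count is the coefficient at [z] of the class sum of [x] times the sum [T] of all torsion
    elements; [T] is constant on classes by [cls_level]. Integer coefficients keep the counts
    exact. *)
Lemma level_count x z z' : z' \in cls z ->
  count (fun u => u.1 == z'.1) (cls x) = count (fun u => u.1 == z.1) (cls x).
Proof.
move=> zz; pose A := galg int G.
pose T : A := gsum A [seq tor j | j <- enum 'Z_p].
have coefT y : coef y T = (y.1 == 0)%:R.
  rewrite coef_gsum count_uniq_mem; last first.
    by rewrite map_inj_uniq ?enum_uniq //; apply: tor_inj.
  congr (_%:R); congr nat_of_bool; apply/mapP/eqP => [[j _ ->] //|y0].
  by exists y.2; rewrite ?mem_enum // -torP.
have ST : classwise cls T.
  move=> u v vu; rewrite !coefT; congr (_%:R); congr nat_of_bool.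
  by case: (cls_level p_pr F0 hS hH vu) => ->; rewrite ?oppr_eq0.
have := classwise_mul F0 hS (classwise_cls hS A x) ST zz.
rewrite !coef_gsumM.
have E y : \sum_(u <- cls x) coef (y - u) T = (count (fun u => u.1 == y.1) (cls x))%:R.
  rewrite -sum_nat_seq natr_sum; apply: eq_bigr => u _.
  by rewrite coefT fstD fstN subr_eq0 eq_sym.
by rewrite !E => /eqP; rewrite eqr_nat => /eqP.
Qed.

(** * The case where the class of [(1, 0)] misses an element of level 1 *)

Section NotFull.
Variable j0 : 'Z_p.
Hypothesis not_full : ((1, j0) : G) \notin cls (1, 0).

Lemma thin_generator : exists c c', forall y, y \in cls (1, c) ->
  y = (1, c) \/ y = (-1, c').
Proof.
have [m [s [c [em thin]]]] := thin_class p_pr F0 hS hH not_full.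
have m0 : 0 < m%:Z by rewrite em.
(* By [level_count], level [-m] carries either no element of the class or as many as level [m],
   namely one. *)
have [c' hc'] : exists c', forall y, y \in cls (m%:Z, c) ->
    y = (m%:Z, c) \/ y = (- m%:Z, c').
  pose neg := [seq y <- cls (m%:Z, c) | y.1 == - m%:Z].
  have pos y : y \in cls (m%:Z, c) -> y.1 = m%:Z -> y = (m%:Z, c).
    move=> yc y1; apply: grp_eq => //; apply: thin.
    by have <- : y = (m%:Z, y.2) by apply: grp_eq.
  case en : neg => [|y0 s0].
    exists 0 => y yc; left; apply: pos => //.
    case: (cls_level p_pr F0 hS hH yc) => // y1.
    have : y \in neg by rewrite mem_filter y1 eqxx.
    by rewrite en.
  exists y0.2 => y yc.
  case: (cls_level p_pr F0 hS hH yc) => /= y1; first by left; apply: pos.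
  have : y0 \in neg by rewrite en mem_head.
  rewrite mem_filter => /andP[/eqP y01 y0c].
  have := level_count (m%:Z, c) y0c; rewrite y01 /= -size_filter -/neg en /=.
  rewrite -(eq_in_count (a1 := pred1 ((m%:Z, c) : G))) => [|u uc /=]; last first.
    by apply/eqP/eqP => [-> //|/pos ->].
  rewrite count_uniq_mem ?(sr_uniq hS) // (cls_refl hS) => -[/size0nil s00].
  have : y \in neg by rewrite mem_filter y1 eqxx.
  rewrite en s00 inE => /eqP ->; right; apply: grp_eq => //.
exists c, c' => y yc; have := cls_level p_pr F0 hS hH yc.
have e1 : ((1, c) : G) = (m%:Z, c) + (- s%:Z * p%:Z, 0).
  (* The shift by [- s p] returns from level [m] to level 1. Its class contains at most itself and
     its inverse, so comparing levels below settles which sums can occur. *)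
  by apply: grp_eq; rewrite ?fstD ?sndD /= ?addr0 // em; lia.
rewrite e1 in yc; have [u [v [uc vc ->]]] := cls_add F0 hS yc.
rewrite fstD; have := hc' _ uc; have := cls_sub p_pr F0 hS hH vc.
have em' : m%:Z = 1 + s%:Z * p%:Z by rewrite em; lia.
have ps : 0 <= s%:Z * p%:Z by [].
move=> [] -> [] -> lv; [left|right|left|right]; apply: grp_eq;
  rewrite ?sndD ?fstD ?sndN ?fstN /= ?oppr0 ?addr0 //; move: lv;
  rewrite ?fstN /=; lia.
Qed.

(** Here [b] has level 1, so <b> x Z_p is the whole group and [flip_transitive] covers every
    class. *)
Lemma transitive_not_full x y : y \in cls x ->
  exists e i a, preserves e i a /\ haut e i a x = y.
Proof.
move=> yx; have [c [c' hc]] := thin_generator.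
pose b : G := (1, c); pose bs : G := (-1, c').
have xE z : z = b *~ z.1 + tor (z.2 - c * z.1%:~R).
  apply: grp_eq; rewrite ?fst_tor ?fstMz ?mul1r //.
  by rewrite sndD sndMz subrKC.
(* This value makes [haut e (i e a) a] send [b] to [flip b bs e]. *)
pose i e a := (flip b bs e).2 - a * c.
have hautE e a z : haut e (i e a) a z
    = flip b bs e *~ z.1 + tor (a * (z.2 - c * z.1%:~R)).
  apply: grp_eq; rewrite ?fst_haut ?fst_tor ?fstMz; first by case: (e); rewrite ?expr1 ?expr0.
  by rewrite snd_haut sndD sndMz /i /=; ring.
have [] := @flip_transitive F p cls p_pr F0 hS hH 1 b bs isT erefl erefl hc x.1
   (x.2 - c * x.1%:~R) y; first by rewrite -xE.
move=> e [a [a0 st ->]]; exists e, (i e a), a; split=> //.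
by split=> // z; rewrite hautE [in X in _ \in cls X](xE z); apply: st.
Qed.

End NotFull.

(** * The case where the class of [(1, 0)] contains all of level 1 *)

Section Full.
Hypothesis full1 : forall j, ((1, j) : G) \in cls (1, 0).

(** Fullness is carried from level 1 to [1 + s p] by an element of <z^p>; for [s > 0] the opposite
    sign of that element is excluded by [cls_level]. *)
Lemma full_shift (s : nat) j j' :
  ((1 + s%:Z * p%:Z, j') : G) \in cls (1 + s%:Z * p%:Z, j).
Proof.
have e1 : ((1, j) : G) = (1 + s%:Z * p%:Z, j) + (- s%:Z * p%:Z, 0).
  by apply: grp_eq; rewrite ?fstD ?sndD /= ?addr0 //; lia.
have : ((1, j') : G) \in cls (1, j) by rewrite (cls_eq hS (full1 j)).
rewrite e1 => /(cls_add F0 hS)[u [v [ul /(cls_sub p_pr F0 hS hH) hv E]]].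
have ps : 0 <= s%:Z * p%:Z by [].
have := cls_level p_pr F0 hS hH ul; have := congr1 fst E; have := congr1 snd E.
rewrite fstD sndD; suff : u.1 = 1 + s%:Z * p%:Z -> u.2 = j' ->
    ((1 + s%:Z * p%:Z, j') : G) \in cls (1 + s%:Z * p%:Z, j).
  move=> H; case: hv => ->; rewrite ?fstN ?sndN /= ?oppr0 ?addr0 => e2 e3 lv;
  by apply: H; [move: e3 lv => /=; lia|rewrite -e2].
by move=> u1 u2; have <- : u = (1 + s%:Z * p%:Z, j') by apply: grp_eq.
Qed.

Lemma full_level (k : int) j j' : ~~ (p%:Z %| k)%Z -> ((k, j') : G) \in cls (k, j).
Proof.
have pos (n : nat) i i' : ~~ (p%:Z %| n%:Z)%Z -> ((n%:Z, i') : G) \in cls (n%:Z, i).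
  rewrite dvdzE /= => pn.
  have nU : (n%:R : 'Z_p) \is a GRing.unit.
    by apply: Zp_unit_nat; rewrite // coprime_sym prime_coprime.
  (* With [l] inverse to [n] modulo [p], the level [n l] has the form [1 + s p], which is full;
     [cls_muln] then cancels [l]. *)
  pose l : nat := (n%:R^-1 : 'Z_p).
  have nl : ((n * l)%N%:R : 'Z_p) = 1 by rewrite natrM natr_Zp divrr.
  have co : coprime l p.
    have : (l%:R : 'Z_p) \is a GRing.unit by rewrite natr_Zp unitrV.
    by rewrite unitZpE ?prime_gt1 // coprime_sym.
  have nl0 : (0 < n * l)%N.
    by rewrite lt0n; apply: contra_eq_neq nl => ->; rewrite eq_sym oner_eq0.
  have /dvdnP[s es] : (p %| n * l - 1)%N.
    by rewrite /dvdn -(val_Zp_nat (prime_gt1 p_pr)) natrB // nl subrr.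
  have el : ((n * l)%N%:Z = 1 + s%:Z * p%:Z) by lia.
  have mE c : ((n%:Z, c) : G) *+ l = (1 + s%:Z * p%:Z, c *+ l).
    by apply: grp_eq; rewrite ?fstMn ?sndMn //= -el PoszM.
  have := full_shift s (i *+ l) (i' *+ l); rewrite -!mE.
  case/(cls_muln p_pr F0 hS co) => x xi /(mulp_inj_grp p_pr co) ->.
  exact: xi.
case: k => n; first exact: pos.
rewrite NegzE dvdzE abszN -dvdzE => pn.
have eN i : ((- n.+1%:Z, i) : G) = - (n.+1%:Z, - i).
  by apply: grp_eq; rewrite ?fstN ?sndN ?opprK.
by rewrite !eN (clsN hS) opprK; apply: pos.
Qed.

Lemma mem_full_level x y : y.1 = x.1 -> ~~ (p%:Z %| x.1)%Z -> y \in cls x.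
Proof. by case: x y => [k j] [l j'] /= ->; apply: full_level. Qed.

(** The torsion part moves by [i] times the level: this is zero at levels divisible by [p], and the
    other levels are full. *)
Lemma translations_preserve i : preserves false i 1.
Proof.
split=> [|x]; first exact: oner_neq0.
have [/dvdzP[k e]|nd] := boolP (p%:Z %| x.1)%Z.
  have -> : haut false i 1 x = x; last exact: (cls_refl hS).
  apply: grp_eq; rewrite /haut /= mul1r //.
  by rewrite e intrM [p%:~R](Zp_p0 p_pr) !mulr0 addr0.
by apply: mem_full_level; rewrite // fst_haut mul1r.
Qed.

Lemma translate x y : y \in cls x -> y.1 = x.1 -> ~~ (p%:Z %| x.1)%Z ->
  exists i, haut false i 1 x = y.
Proof.
move=> yx y1 nd; have U : (x.1%:~R : 'Z_p) \is a GRing.unit by exact: Zp_unit_int.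
exists ((y.2 - x.2) / x.1%:~R); apply: grp_eq; rewrite /haut /= ?mul1r //.
by rewrite divrK // subrKC.
Qed.

Let b : G := (p%:Z, 0).
Let bs : G := (- p%:Z, 0).

Let hb y : y \in cls b -> y = b \/ y = bs.
Proof.
move=> yb; have := @cls_sub F p cls p_pr F0 hS hH 1 y; rewrite mul1r => /(_ yb).
case=> ->; [by left|right].
by apply: grp_eq; rewrite ?fstN ?sndN //= oppr0.
Qed.

Let p_gt0 : 0 < p%:Z. Proof. by rewrite ltz_nat prime_gt0. Qed.

Lemma cls_level_mul x n : (forall y, y \in cls x -> y.1 = x.1) ->
  forall y, y \in cls (x *+ n) -> y.1 = (x *+ n).1.
Proof.
move=> lx; elim: n => [|n IH] y; first by rewrite (cls0 hS) => /eqP ->.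
rewrite mulrS => /(cls_add F0 hS)[u [v [ux vx ->]]].
by rewrite !fstD (lx _ ux) (IH _ vx).
Qed.

Lemma flipE e (k : int) j : flip b bs e *~ k + tor j = ((-1) ^+ e * (p%:Z * k), j).
Proof.
apply: grp_eq; first by rewrite (flip_level (r := p%:Z)).
rewrite sndD /=; suff -> : (flip b bs e *~ k).2 = 0 by rewrite add0r.
have z2 z (n : nat) : z.2 = 0 -> (z *+ n).2 = 0 :> 'Z_p.
  by move=> z0; rewrite sndMn z0 mul0rn.
by case: k => n; case: e; rewrite ?NegzE ?mulrNz ?sndN -pmulrn z2 ?oppr0.
Qed.

(** Levels divisible by [p] are covered by the hypothesis and the others are full, so only a change
    of sign at a level prime to [p] needs an argument. *)
Lemma preserves_stabilizes e a : a != 0 -> stabilizes cls b bs e a -> preserves e 0 a.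
Proof.
move=> a0 st; split=> // x.
have [/dvdzP[k ek]|nd] := boolP (p%:Z %| x.1)%Z.
  have := st k x.2; rewrite flipE -[b]/(flip b bs false) flipE mul1r.
  congr (_ \in cls _); apply: grp_eq; rewrite /haut //= ?ek ?mul0r ?addr0 //; ring.
case: e st => st; last first.
  by apply: mem_full_level; rewrite // fst_haut mul1r.
(* If the class of [x] stays at one level, so does that of [x *+ p]; but the hypothesis puts an
   element of opposite level into the latter. *)
have [/hasP[y yx /eqP y1]|/hasPn no] := boolP (has (fun y => y.1 == - x.1) (cls x)).
  rewrite -(cls_eq hS yx); apply: mem_full_level; rewrite y1.
    by rewrite fst_haut mulN1r.
  by rewrite dvdzE abszN -dvdzE.
have lx y : y \in cls x -> y.1 = x.1.
  by move=> yx; case: (cls_level p_pr F0 hS hH yx) => // y1; have := no y yx; rewrite y1 eqxx.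
have := st x.1 0; rewrite -[b *~ _]/(flip b bs false *~ _) !flipE mulr0 mul1r.
have -> : ((p%:Z * x.1, 0) : G) = x *+ p.
  by apply: grp_eq; rewrite ?fstMn ?sndMn ?Zp_mulp //= mulrC.
move/(cls_level_mul lx); rewrite fstMn /= => e.
suff x0 : x.1 = 0 by rewrite x0 dvdz0 in nd.
by move: e; rewrite expr1; move: (x.1) p_gt0 => k; nia.
Qed.

Lemma transitive_full x y : y \in cls x ->
  exists e i a, preserves e i a /\ haut e i a x = y.
Proof.
move=> yx; have trans := @flip_transitive F p cls p_pr F0 hS hH p%:Z b bs p_gt0 erefl erefl hb.
have [/dvdzP[k ek]|nd] := boolP (p%:Z %| x.1)%Z.
  have xE : x = b *~ k + tor x.2.
    rewrite -[b]/(flip b bs false) flipE mul1r mulrC -ek.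
    exact: surjective_pairing.
  rewrite xE in yx; have [e [a [a0 st ->]]] := trans _ _ _ yx.
  exists e, 0, a; split; first exact: preserves_stabilizes.
  by rewrite flipE; apply: grp_eq; rewrite /haut //= ?ek ?mul0r ?addr0 //; ring.
case: (cls_level p_pr F0 hS hH yx) => y1.
  have [i <-] := translate yx y1 nd; exists false, i, 1; split=> //.
  exact: translations_preserve.
(* Otherwise [x = (x + b) - b] puts [y + b], of level [p - x.1], into the class of [x + b], which
   forces [x.1 = 0]. *)
have bsb : bs \in cls b.
  apply: contraT => nbs.
  have : y \in cls (x + b - b) by rewrite addrK.
  case/(cls_add F0 hS) => u [v [ux]]; rewrite (clsN hS) => vb E.
  have ev : v = - b.
    case: (hb vb) => [<-|e]; first by rewrite opprK.
    by rewrite e (negPf nbs) in vb.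
  have := cls_level p_pr F0 hS hH ux; have := congr1 fst E.
  rewrite ev !fstD fstN y1 /= => e1 e2.
  suff x0 : x.1 = 0 by rewrite x0 dvdz0 in nd.
  by move: e1 e2 p_gt0; move: (u.1) (x.1) => k l; lia.
(* Since [bs] is in the class of [b], some class-preserving automorphism inverts levels; a
   translation then corrects the torsion part. *)
have [] := trans 1 0 bs; first by rewrite mulr1z addr0.
move=> e [a [a0 st E]].
have e_true : e.
  have := congr1 fst E; rewrite flipE /=; case: (e) => //.
  by rewrite expr0; move: p_gt0; lia.
rewrite e_true in st; have pr := preserves_stabilizes a0 st.
pose z := haut true 0 a x.
have z1 : z.1 = - x.1 by rewrite /z /haut /= expr1 mulN1r.
have [i iE] : exists i, haut false i 1 z = y.
  apply: translate; first by rewrite (cls_eq hS (pr.2 x)).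
    by rewrite z1 y1.
  by rewrite z1 dvdzE abszN -dvdzE.
do 3!eexists; split; last by rewrite -iE /z haut_comp.
exact: preserves_comp (translations_preserve i) pr.
Qed.

End Full.

Lemma preserves_transitive x y : y \in cls x ->
  exists e i a, preserves e i a /\ haut e i a x = y.
Proof.
have [/forallP full|/forallPn[j nf]] :=
  boolP [forall j : 'Z_p, ((1, j) : G) \in cls (1, 0)].
  exact: transitive_full.
exact: transitive_not_full nf _ _.
Qed.

(** The group consists of the [haut e i a] keeping every element in its class. It is finite because
    its parameters are, and its orbits are whole classes by [preserves_transitive]. *)
Lemma schur_ring_automorphic : is_automorphic cls.
Proof.
pose P (u : bool * 'Z_p * 'Z_p) := preserves u.1.1 u.1.2 u.2.
have [s sP] := filter_prop P (enum {: bool * 'Z_p * 'Z_p}).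
pose hs := [seq haut u.1.1 u.1.2 u.2 | u <- s].
have hsP h : List.In h hs <-> exists e i a, preserves e i a /\ haut e i a = h.
  split; first by case/In_map => -[[e i] a] /sP[_ pr] <-; exists e, i, a.
  move=> [e [i [a [pr <-]]]]; apply/In_map; exists (e, i, a) => //.
  by apply/sP; rewrite mem_enum.
exists hs; split; last first.
  move=> x y; split.
    case/preserves_transitive => e [i [a [pr E]]].
    by exists (haut e i a) => //; apply/hsP; exists e, i, a.
  by case=> h /hsP[e [i [a [[a0 pr] <-]]]] <-.
split.
- by move=> h /hsP[e [i [a [[a0 pr] <-]]]]; apply: haut_aut.
- exists (haut false 0 1); last exact: haut_id.
  apply/hsP; exists false, 0, 1; split=> //; split; first exact: oner_neq0.
  by move=> x; rewrite haut_id (cls_refl hS).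
- move=> h1 h2 /hsP[e [i [a [pr <-]]]] /hsP[e' [i' [a' [pr' <-]]]].
  exists (haut (e (+) e') (a * i' + i * (-1) ^+ e') (a * a')).
    by apply/hsP; do 3!eexists; split; first exact: preserves_comp pr pr'.
  by move=> x /=; rewrite haut_comp.
move=> h1 /hsP[e [i [a [[a0 pr] <-]]]].
have [i' K1 K2] := haut_inv e i p_pr a0.
exists (haut e i' a^-1); last exact: K1.
apply/hsP; exists e, i', a^-1; split=> //; split.
  by rewrite -Zp_unit // unitrV Zp_unit.
by move=> x; rewrite (cls_sym hS) -{1}(K2 x).
Qed.

End Automorphic.

Theorem theorem4p1 (F : fieldType) (hF : [pchar F] =i pred0) (p : nat)
  (hp : fermat_prime p \/ safe_prime p)
  (cls : grp p -> seq (grp p)) (hS : is_schur_ring F cls)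
  (hsub : is_S_subgroup cls (@zp_sub p)) :
  is_automorphic cls.
Proof.
by apply: schur_ring_automorphic hS hsub => //; case: hp => -[].
Qed.
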